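(* Let $1 \le k < n$ be integers. There exists a sequence of combinatorial mutations taking the GT-polytope for $\mathrm{Gr}(k,n)$ to the FFLV-polytope for $\mathrm{Gr}(k,n)$ such that all intermediate polytopes are matching field polytopes. Explicitly: there exist an integer $s \ge 0$ and matching fields $\Lambda_0, \Lambda_1, \dots, \Lambda_s$ for $\mathrm{Gr}(k,n)$ such that $\Lambda_0$ is the diagonal matching field (so that $P_{\Lambda_0}$ is the GT-polytope), $P_{\Lambda_s}$ is unimodular equivalent to the FFLV-polytope $\mathcal{C}(Q_{k,n})$, and for each $i \in \{1, \dots, s\}$ the polytope $P_{\Lambda_i}$ is a combinatorial mutation of $P_{\Lambda_{i-1}}$ in $\mathbb{R}^{k \times n}$.
   Context: Write $[n]=\{1,\dots,n\}$ and $\binom{[n]}{k}$ for the set of $k$-subsets of $[n]$. Combinatorial mutation. Equip $\mathbb{R}^d$ with the standard inner product. For a primitive lattice point $w \in \mathbb{Z}^d$ and a lattice polytope $F \subseteq w^\perp$, the tropical map is $\varphi_{w,F}: \mathbb{R}^d \to \mathbb{R}^d$, $x \mapsto x - x_{\min} w$, where $x_{\min} = \min\{\langle x, f\rangle : f \in F\}$. If $P \subseteq \mathbb{R}^d$ is a lattice polytope and $Q := \varphi_{w,F}(P)$ is a lattice polytope (in particular convex), then $Q$ is called a combinatorial mutation of $P$. Here $\mathbb{R}^{k\times n}$ carries the lattice $\mathbb{Z}^{k\times n}$. Matching fields. A matching field for $\mathrm{Gr}(k,n)$ is a map $\Lambda: \binom{[n]}{k} \to S_k$. For $I = \{i_1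 < \dots < i_k\}$ the tuple of $\Lambda$ associated to $I$ is $(i_{\sigma(1)}, \dots, i_{\sigma(k)})$ with $\sigma = \Lambda(I)$; $\Lambda$ is identified with its set of tuples. Let $e_{i,j}$ be the standard basis of $\mathbb{R}^{k\times n}$. The matching field polytope is $P_\Lambda = \mathrm{Conv}\{ \sum_{i=1}^k e_{i,j_i} : (j_1,\dots,j_k) \text{ a tuple of } \Lambda\} \subseteq \mathbb{R}^{k \times n}$. The diagonal matching field sends every $k$-subset to the identity permutation (its tuples are the increasing ones). GT- and FFLV-polytopes. Let $Q_{k,n} = \{(i,j)\in\mathbb{Z}^2 : 1\le i\le k,\ 1 \le j \le n-k\}$ be the poset with $(a,b) \le (c,d)$ iff $a \le c$ and $b \le d$. For a finite poset $\Pi=\{p_1,\dots,p_d\}$, the order polytope is $\mathcal{O}(\Pi)=\{x\in\mathbb{R}^d : x_i\le x_j \text{ if } p_i<p_j,\ 0\le x_i\le 1 \text{ for all } i\}$ and the chain polytope is $\mathcal{C}(\Pi)=\{x\in\mathbb{R}^d : x_{i_1}+\dots+x_{i_s}\le 1 \text{ if } p_{i_1}<\dots<p_{i_s},\ x_i\ge 0 \text{ for all } i\}$. The GT-polytope for $\mathrm{Gr}(k,n)$ is $\mathcal{O}(Q_{k,n})$, which is identified, via a unimodular equivalence, with the matching field polytope of the diagonal matching field. The FFLV-polytope for $\mathrm{Gr}(k,n)$ is $\mathcal{C}(Q_{k,n})$, identified up to unimodular equivalence with a matching field polytope. Two lattice polytopes $P,Q$ are unimodular equivalent if there is an affine isomorphism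 between their affine spans that maps $P$ onto $Q$ and restricts to a bijection between their distinguished lattices, the distinguished lattice of a polytope being the $\mathbb{Z}$-affine span of its vertices. *)

(* Defs.v *)
From HB Require Import structures.
From mathcomp Require Import all_boot all_order all_algebra all_fingroup.
From mathcomp Require Import all_classical all_reals.

Set Implicit Arguments.
Unset Strict Implicit.
Unset Printing Implicit Defensive.

Import Order.TTheory GRing.Theory Num.Theory.
Local Open Scope classical_set_scope.
Local Open Scope ring_scope.

Section Hulls.
Variables (R : realType) (E : lmodType R).
Implicit Types (A P : set E) (C : set R).

(* Finite combinations of points of A whose coefficients lie in C and sum to 1:
   the three hulls below only differ in the coefficients they allow. *)
Definition hull_with C A : set E :=
  [set x | exists m (c : 'I_m -> R) (v : 'I_m -> E),
     [/\ forall i, C (c i), forall i, A (v i), \sum_i c i = 1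
       & x = \sum_i c i *: v i]].

Definition conv A := hull_with [set t | 0 <= t] A.
Definition aff_span A := hull_with setT A.
Definition int_aff_span A := hull_with [set t | t \is a Num.int] A.

Definition vertices P : set E :=
  [set x | P x /\ forall y z t, P y -> P z -> 0 < t < 1 ->
     x = t *: y + (1 - t) *: z -> y = z].

Definition dist_lattice P := int_aff_span (vertices P).

End Hulls.

(* f is only constrained on the affine span of P; its values elsewhere are
   irrelevant. *)
Definition unimodular_equiv (R : realType) (E E' : lmodType R)
    (P : set E) (Q : set E') :=
  exists f : E -> E',
    [/\ forall x y t, aff_span P x -> aff_span P y ->
          f (t *: x + (1 - t) *: y) = t *: f x + (1 - t) *: f y,
        set_bij (aff_span P) (aff_span Q) f,
        f @` P = Q
      & set_bij (dist_lattice P) (dist_lattice Q) f].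

Section Mutation.
Variables (R : realType) (k n : nat).
Local Notation V := 'M[R]_(k, n).

Definition dotmx (x y : V) : R := \sum_i \sum_j x i j * y i j.

Definition lattice_polytope (P : set V) :=
  exists s : seq V, [/\ s != [::],
    forall v, v \in s -> v \is a mxOver Num.int & P = conv [set` s]].

Definition primitive_mx (w : 'M[int]_(k, n)) :=
  \big[gcdn/0%N]_i \big[gcdn/0%N]_j `|w i j|%N = 1%N.

(* The least element of A; the default 0 is never used below, where A is the
   image of a nonempty polytope under a linear form. *)
Definition min_of (A : set R) : R := xget 0 (A `&` lbound A).

Definition tropical_map (w : V) (F : set V) (x : V) : V :=
  x - min_of [set dotmx x f | f in F] *: w.

Definition combinatorial_mutation (P Q : set V) :=
  exists (w : 'M[int]_(k, n)) (F : set V),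
    let wR := map_mx intr w in
    [/\ primitive_mx w,
        lattice_polytope F /\ F `<=` [set f | dotmx wR f = 0],
        lattice_polytope P,
        Q = tropical_map wR F @` P
      & lattice_polytope Q].

End Mutation.

Section MatchingFields.
Variables k n : nat.

Definition ksubset := {I : {set 'I_n} | #|I| == k}.

Definition matching_field := {ffun ksubset -> 'S_k}.

(* enum_val lists the elements of I in increasing order (enum_val_ksubset_lt),
   so entry r of the tuple is i_{sigma(r)} with sigma = L I; indices start
   at 0. *)
Definition mf_tuple (L : matching_field) (I : ksubset) (r : 'I_k) : 'I_n :=
  enum_val (cast_ord (esym (eqP (valP I))) (L I r)).

Definition mf_point (R : realType) (L : matching_field) (I : ksubset) :
    'M[R]_(k, n) :=
  \sum_(r < k) delta_mx r (mf_tuple L I r).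

Definition mf_polytope (R : realType) (L : matching_field) : set 'M[R]_(k, n) :=
  conv (range (mf_point R L)).

Definition diagonal_mf : matching_field := [ffun => 1%g].

End MatchingFields.

Arguments mf_polytope {k n} R L.

Lemma enum_val_ksubset_lt n (I : {set 'I_n}) (a b : 'I_#|I|) :
  (a < b)%N -> (enum_val a < enum_val b)%N.
Proof.
move=> ab.
have sI : sorted ltn (map val (enum I)).
  rewrite /enum_mem sorted_map.
  apply: (@sorted_filter _ (relpre val ltn)); first by move=> ? ? ?; apply: ltn_trans.
  by rewrite -enumT -sorted_map val_enum_ord iota_ltn_sorted.
have x0 := enum_val a.
rewrite !(enum_val_nth x0) -!(nth_map x0 0%N) -?cardE //.
by apply: (sorted_ltn_nth ltn_trans 0%N sI) => //; rewrite inE size_map -cardE.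
Qed.

Section PosetPolytopes.
Variables (R : realType) (d : Order.disp_t) (T : finPOrderType d).
Local Notation V := {ffun T -> R^o}.

Definition order_polytope : set V :=
  [set x | (forall p q, (p < q)%O -> x p <= x q) /\
           (forall p, 0 <= x p <= 1)].

Definition chain_polytope : set V :=
  [set x | (forall s : seq T, sorted <%O s -> \sum_(p <- s) x p <= 1) /\
           (forall p, 0 <= x p)].

End PosetPolytopes.

Arguments order_polytope R {d} T.
Arguments chain_polytope R {d} T.

(* Ordinals are 0-based; *p carries the componentwise order. *)
Definition grid_poset (k n : nat) := ('I_k *p 'I_(n - k))%type.

(* Main.v *)
Require Import Defs.
From mathcomp Require Import all_boot all_order all_algebra all_fingroup.
From mathcomp Require Import all_classical all_reals.
From mathcomp Require Import zify ring lra.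

Import Defs.

(** Every polytope on the path comes from a matching field chosen greedily.
Give each row [p] an injective key [kap p] on the columns.  A [k]-subset [I] is
distributed over the rows from the last one upwards: row [p] takes, among the
elements of [I] that are left, the one with the largest key [kap p].  So the
tuples of the field are the [j] with [kap p (j q) < kap p (j p)] for all rows
[q < p] (predicate [greedy]).  The identity keys give the diagonal field.  The
keys [fflv_key p] prefer the columns from [p] to [k - 1], then [k], [k + 1], ...,
[n - 1] in this order, and last the columns before [p].  They give the
Feigin-Fourier-Littelmann-Vinberg field: each column [p < k] that occurs is in row
[p], and the entries that are at least [k] decrease from row to row.

The elementary mutation exchanges two columns [a], [b] that are adjacent for the
key of row [q = r + 1], when row [r] already has the new key.  Only the tuples
with [a] in row [r] and [b] in row [q] change: these two entries are swapped,
which moves the vertex by the fixed vector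
[w = e_(r,b) + e_(q,a) - e_(r,a) - e_(q,b)].  A linear form [h] orthogonal to [w]
is [-1] on these tuples, [0] or [1] on the others, so the vertices are moved by
the tropical map of the segment from [0] to [h] ([dot_swap_factor],
[swap_point]).  That the image of the whole polytope is the new polytope follows
from an exchange property: two vertices with [h = 1] and [h = -1] have the same
sum as two vertices with [h = 0], obtained by exchanging the entries in the rows
after [r] of the two tuples ([splice_greedy]).  Hence no point of the polytope
needs vertices from both sides of the hyperplane [h = 0] ([conv_halfspace]), and
on each side the tropical map is linear.  The same holds for the inverse map, and
the two inclusions give a mutation ([two_piece_mutation],
[adjacent_swap_mutation]).

Doing this for the rows in turn changes the key of a whole initial block of rows
by an adjacent transposition ([transposition_path]), and bubble sort then changes
it to any other key, as long as the rows after the block are compatible with each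
transposition ([sort_path]).  The path to the final field has [k + 1] such
phases: all rows go from the identity to [fflv_key k], and then, for
[m = k - 1, ..., 0], the rows up to [m] go from [fflv_key m.+1] to [fflv_key m]
([diagonal_to_fflv]).

The order polytope and the chain polytope are convex hulls of the indicators of
filters and of antichains, because a point whose coordinates are lengths of
intervals in [0, 1] is the average over a level [t] of the indicators of the
intervals that contain [t] ([conv_levels]).  These indicators are the images of
the tuples of the first and of the last field under affine maps that have an
affine left inverse on the vertices, which gives the unimodular equivalences. *)

Set Implicit Arguments.
Unset Strict Implicit.
Unset Printing Implicit Defensive.

Import Order.TTheory GRing.Theory Num.Theory.
Local Open Scope classical_set_scope.
Local Open Scope ring_scope.

(** * Convex combinations and affine maps *)

Section WeightedCombinations.
Variables (R : realType) (E : lmodType R).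
Implicit Types (A X : set E) (s t : R) (x y : E).

(** Letting the total weight [t] vary makes this notion additive, so that a convex
combination can be assembled summand by summand; [wcomb A 1] is [conv A]. *)
Definition wcomb A t x :=
  exists m (c : 'I_m -> R) (v : 'I_m -> E),
    [/\ forall i, 0 <= c i, forall i, A (v i), \sum_i c i = t
      & x = \sum_i c i *: v i].

Lemma wcomb0 A : wcomb A 0 0.
Proof.
exists 0%N, (fun=> 0), (fun=> 0).
by split; [case | case | rewrite big_ord0 | rewrite big_ord0].
Qed.

Lemma wcombD A s t x y : wcomb A s x -> wcomb A t y -> wcomb A (s + t) (x + y).
Proof.
move=> [m [c [v [c0 Av <- ->]]]] [m' [c' [v' [c0' Av' <- ->]]]].
exists (m + m')%N, (fun i => match fintype.split i with inl j => c j | inr j => c' j end),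
  (fun i => match fintype.split i with inl j => v j | inr j => v' j end).
split=> [i|i||]; try by case: (fintype.split i).
  rewrite big_split_ord /=; congr (_ + _); apply: eq_bigr => i _.
    by rewrite (unsplitK (inl i)).
  by rewrite (unsplitK (inr i)).
rewrite big_split_ord /=; congr (_ + _); apply: eq_bigr => i _.
  by rewrite (unsplitK (inl i)).
by rewrite (unsplitK (inr i)).
Qed.

Lemma wcomb_scale A t x : 0 <= t -> A x -> wcomb A t (t *: x).
Proof.
by move=> t0 Ax; exists 1%N, (fun=> t), (fun=> x); split; rewrite // big_ord1.
Qed.

Lemma wcomb_sum A (I : Type) (r : seq I) (P : pred I) (t : I -> R) (x : I -> E) :
  (forall i, P i -> wcomb A (t i) (x i)) ->
  wcomb A (\sum_(i <- r | P i) t i) (\sum_(i <- r | P i) x i).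
Proof.
by move=> H; apply: (big_ind2 (wcomb A)) => //; [exact: wcomb0 | move=> *; exact: wcombD].
Qed.

Lemma conv_sub A B : A `<=` B -> conv A `<=` conv B.
Proof.
by move=> AB x [m [c [v [c0 Av c1 ->]]]]; exists m, c, v; split=> // i; exact/AB.
Qed.

Lemma sub_conv A : A `<=` conv A.
Proof. by move=> x Ax; rewrite -[x]scale1r; exact: wcomb_scale. Qed.

End WeightedCombinations.

Section Affine.
Variable R : realType.

Definition affine (E E' : lmodType R) (f : E -> E') :=
  forall m (c : 'I_m -> R) (v : 'I_m -> E), \sum_i c i = 1 ->
    f (\sum_i c i *: v i) = \sum_i c i *: f (v i).

Lemma affine_cst (E E' : lmodType R) (y : E') : affine (fun _ : E => y).
Proof. by move=> m c v c1; rewrite -scaler_suml c1 scale1r. Qed.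

Lemma affineB (E E' : lmodType R) (f g : E -> E') :
  affine f -> affine g -> affine (fun x => f x - g x).
Proof.
move=> fa ga m c v c1; rewrite fa // ga // -sumrB.
by apply: eq_bigr => i _; rewrite scalerBr.
Qed.

Lemma affine_sum (E E' : lmodType R) (I : Type) (r : seq I) (P : pred I)
    (f : I -> E -> E') :
  (forall i, affine (f i)) -> affine (fun x => \sum_(i <- r | P i) f i x).
Proof.
move=> fa m c v c1; under eq_bigr do rewrite fa //.
by rewrite exchange_big; apply: eq_bigr => i _; rewrite scaler_sumr.
Qed.

Lemma affine_mx (E : lmodType R) k n (f : E -> 'M[R]_(k, n)) :
  (forall i j, affine (fun x => f x i j : R^o)) -> affine f.
Proof.
move=> fa m c v c1; apply/matrixP => i j; rewrite summxE.
have := fa i j m c v c1; rewrite /= => ->.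
by apply: eq_bigr => l _; rewrite mxE.
Qed.

Lemma affine_ffun (E : lmodType R) (T : finType) (f : E -> {ffun T -> R^o}) :
  (forall i, affine (fun x => f x i : R^o)) -> affine f.
Proof.
move=> fa m c v c1; apply/ffunP => i; rewrite sum_ffunE.
have := fa i m c v c1; rewrite /= => ->.
by apply: eq_bigr => l _; rewrite ffunE.
Qed.

Lemma affine_eval (T : finType) i : affine (fun x : {ffun T -> R^o} => x i : R^o).
Proof. by move=> m c v c1; rewrite sum_ffunE; apply: eq_bigr => l _; rewrite ffunE. Qed.

Lemma affine2 (E E' : lmodType R) (f : E -> E') : affine f ->
  forall t x y, f (t *: x + (1 - t) *: y) = t *: f x + (1 - t) *: f y.
Proof.
move=> fa t x y.
have := fa 2%N (fun i => if i == ord0 then t else 1 - t) (fun i => if i == ord0 then x else y).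
rewrite !big_ord_recl !big_ord0 /= !addr0; apply.
by rewrite addrC subrK.
Qed.

End Affine.

Definition exchange (R : realType) (E : lmodType R) (h : E -> R) (X : set E) :=
  forall u v, X u -> X v -> h u = 1 -> h v = -1 ->
  exists u' v', [/\ X u', X v', h u' = 0, h v' = 0 & u + v = u' + v'].

Section Halfspace.
Variables (R : realType) (E : lmodType R) (X : set E) (h : E -> R).
Hypothesis haff : affine (h : E -> R^o).
Hypothesis hval : forall v, X v -> [\/ h v = -1, h v = 0 | h v = 1].
Hypothesis hexch : exchange h X.

(** Since [h x >= 0], the weight [p] that a combination gives to the vertices with
[h = 1] is at least the weight [d] of those with [h = -1].  Couple the two groups
by the product weights [c i * c j / p]: this uses up all the negative vertices,
and the exchange property replaces each coupled pair by two vertices with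
[h = 0]. *)
Lemma conv_halfspace x :
  conv X x -> 0 <= h x -> conv (X `&` [set v | 0 <= h v]) x.
Proof.
move=> [m [c [v [cC Xv c1 ->]]]]; have -> := haff v c1 => hx.
have c0 i : 0 <= c i by exact: cC.
pose P i := h (v i) == 1; pose N i := h (v i) == -1.
have PN i : P i -> N i = false.
  by rewrite /P /N => /eqP ->; apply/eqP => ?; lra.
pose p := \sum_(i | P i) c i; pose d := \sum_(i | N i) c i.
have p0 : 0 <= p by apply: sumr_ge0.
have d0 : 0 <= d by apply: sumr_ge0.
have dp : d <= p.
  rewrite -subr_ge0; suff -> : p - d = \sum_i c i * h (v i) by [].
  rewrite /p /d (big_mkcond P) (big_mkcond N) -sumrB; apply: eq_bigr => i _.
  rewrite /P /N /=; case: (hval (Xv i)) => ->; rewrite ?eqxx.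
  - by rewrite ifF; [lra | apply/eqP => ?; lra].
  - by rewrite !ifF; [lra | apply/eqP => ?; lra | apply/eqP => ?; lra].
  - by rewrite ifF; [lra | apply/eqP => ?; lra].
(* p / p = 1 except when p = 0, and then d = 0 too *)
have cpp i : N i -> c i * (p / p) = c i.
  move=> Ni; have [p_0|pn0] := eqVneq p 0; last by rewrite divff // mulr1.
  have d_0 : d = 0 by apply/eqP; rewrite eq_le d0 -p_0 dp.
  have : c i <= d by rewrite /d (bigD1 i) //= lerDl sumr_ge0.
  by rewrite d_0 => ci; have -> : c i = 0 by [apply/eqP; rewrite eq_le ci c0]; rewrite mul0r.
(* b is the coupling, a the weight that it leaves on each vertex *)
pose a i := if P i then c i * (1 - d / p) else if N i then 0 else c i.
pose b i j := if P i && N j then c i * c j / p else 0.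
have rowb i : \sum_j b i j = if P i then c i * (d / p) else 0.
  rewrite /b; case: (P i) => /=; last by rewrite big1.
  by rewrite -big_mkcond /= -mulr_suml -mulr_sumr mulrA.
have colb j : \sum_i b i j = if N j then c j else 0.
  rewrite /b; case Nj: (N j); last by rewrite big1 // => i _; rewrite andbF.
  rewrite -[RHS]cpp //; under eq_bigr do rewrite andbT.
  by rewrite -big_mkcond /= -!mulr_suml -/p; ring.
have abc i : a i + \sum_j b i j + \sum_j b j i = c i.
  rewrite rowb colb /a; case Pi: (P i); first by rewrite PN //; ring.
  by case: (N i); ring.
have a0 i : 0 <= a i.
  rewrite /a; case: (P i); last by case: (N i).
  apply: mulr_ge0 => //; rewrite subr_ge0.
  have [->|pn0] := eqVneq p 0; first by rewrite invr0 mulr0.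
  by rewrite ler_pdivrMr ?mul1r // lt_def pn0.
have b0 i j : 0 <= b i j.
  by rewrite /b; case: ifP => // _; rewrite mulr_ge0 ?invr_ge0 ?mulr_ge0.
have -> : \sum_i c i *: v i
    = \sum_i a i *: v i + \sum_i \sum_j b i j *: (v i + v j).
  transitivity (\sum_i (a i + \sum_j b i j + \sum_j b j i) *: v i).
    by apply: eq_bigr => i _; rewrite abc.
  under eq_bigr do rewrite 2!scalerDl.
  rewrite 2!big_split /= -addrA; congr (_ + _).
  under [X in _ = X]eq_bigr do (under eq_bigr do rewrite scalerDr; rewrite big_split).
  rewrite big_split /= [X in _ = _ + X]exchange_big /=.
  by congr (_ + _); apply: eq_bigr => i _; rewrite -scaler_suml.
have w1 : 1 = \sum_i a i + \sum_i \sum_j (b i j + b i j).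
  rewrite -c1; transitivity (\sum_i (a i + \sum_j b i j + \sum_j b j i)).
    by apply: eq_bigr => i _; rewrite abc.
  rewrite 2!big_split /= -addrA; congr (_ + _).
  under [X in _ = X]eq_bigr do rewrite big_split.
  by rewrite big_split /= [X in _ = _ + X]exchange_big.
rewrite -[conv _ _]/(wcomb (X `&` [set v | 0 <= h v]) 1 _) w1.
apply: wcombD; apply: wcomb_sum => i _.
  case Ni: (N i).
    rewrite /a ifF ?Ni ?scale0r; first exact: wcomb0.
    by apply/negP => /PN; rewrite Ni.
  apply: wcomb_scale => //; split=> //=.
  by case: (hval (Xv i)) => hi; move: Ni; rewrite /N hi ?eqxx // ler01.
apply: wcomb_sum => j _; rewrite /b; case: ifP => [/andP[/eqP hi /eqP hj]|_].
  have [u [w [Xu Xw hu hw ->]]] := hexch (Xv i) (Xv j) hi hj.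
  rewrite scalerDr; apply: wcombD; apply: wcomb_scale.
  - by rewrite mulr_ge0 ?invr_ge0 ?mulr_ge0.
  - by split; rewrite //= hu.
  - by rewrite mulr_ge0 ?invr_ge0 ?mulr_ge0.
  - by split; rewrite //= hw.
by rewrite scale0r addr0; exact: wcomb0.
Qed.

End Halfspace.

(** * Tropical maps with two linear pieces *)

Section TropicalMaps.
Variables (R : realType) (k n : nat).
Local Notation V := 'M[R]_(k, n).
Implicit Types (x y f w : V).

Lemma dotmxC x y : dotmx x y = dotmx y x.
Proof. by apply: eq_bigr => i _; apply: eq_bigr => j _; rewrite mulrC. Qed.

Lemma dotmx_affine y : affine (fun x => dotmx x y : R^o).
Proof.
move=> m c v c1; rewrite /dotmx.
under eq_bigr do under eq_bigr do rewrite summxE mulr_suml.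
under eq_bigr do rewrite exchange_big.
rewrite exchange_big; apply: eq_bigr => l _; rewrite scaler_sumr.
apply: eq_bigr => i _; rewrite scaler_sumr; apply: eq_bigr => j _.
by rewrite mxE -mulrA.
Qed.

Lemma dotmxDl x y f : dotmx (x + y) f = dotmx x f + dotmx y f.
Proof.
rewrite /dotmx -big_split; apply: eq_bigr => i _; rewrite -big_split.
by apply: eq_bigr => j _; rewrite mxE mulrDl.
Qed.

Lemma dotmxZl (c : R) x f : dotmx (c *: x) f = c * dotmx x f.
Proof.
rewrite /dotmx mulr_sumr; apply: eq_bigr => i _; rewrite mulr_sumr.
by apply: eq_bigr => j _; rewrite mxE mulrA.
Qed.

Lemma dotmx0 x : dotmx x 0 = 0.
Proof. by apply: big1 => i _; apply: big1 => j _; rewrite mxE mulr0. Qed.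

Lemma min_of_eq (A : set R) m : A m -> lbound A m -> min_of A = m.
Proof.
move=> Am lA; apply: xget_unique => // y [Ay ly].
by apply/eqP; rewrite eq_le ly // lA.
Qed.

Lemma tropical_map_segment w f x :
  tropical_map w (conv [set` [:: 0; f]]) x = x - Num.min 0 (dotmx x f) *: w.
Proof.
rewrite /tropical_map; congr (_ - _ *: _); apply: min_of_eq.
  have [h|h] := leP 0 (dotmx x f).
    by exists 0; [apply: sub_conv; rewrite /= inE eqxx | rewrite dotmx0].
  by exists f; [apply: sub_conv; rewrite /= !inE eqxx orbT | ].
move=> _ [g [m [c [v [c0 vF c1 ->]]]] <-].
rewrite [leRHS]dotmxC; have -> := dotmx_affine x v c1.
rewrite -[leLHS]mul1r -c1 mulr_suml; apply: ler_sum => i _.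
apply: ler_wpM2l; first exact: c0.
have := vF i; rewrite /= !inE => /orP[] /eqP ->.
  by rewrite [leRHS]dotmxC dotmx0 ge_min lexx.
by rewrite [leRHS]dotmxC ge_min lexx orbT.
Qed.

Section TwoPieces.
Variables (X X' : set V) (h : V -> R) (w : V).
Hypothesis haff : affine (h : V -> R^o).
Hypothesis hval : forall v, X v -> [\/ h v = -1, h v = 0 | h v = 1].
Hypothesis hexch : exchange h X.
Hypothesis hpos : forall v, X v -> 0 <= h v -> X' v.
Hypothesis hneg : forall v, X v -> h v = -1 -> X' (v + w).

(** On each side of the hyperplane [h = 0] the map is affine, so it suffices to write
[x] with vertices of one side only. *)
Lemma conv_two_pieces x : conv X x -> conv X' (x - Num.min 0 (h x) *: w).
Proof.
move=> Xx; have [hx|hx] := leP 0 (h x).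
  rewrite scale0r subr0; have := conv_halfspace haff hval hexch Xx hx.
  by apply: conv_sub => v [Xv hv]; exact: hpos.
have nhaff : affine ((fun v => - h v) : V -> R^o).
  move=> m c v c1; have /= -> := haff v c1; rewrite -sumrN.
  by apply: eq_bigr => i _; rewrite scalerN.
have nval v : X v -> [\/ - h v = -1, - h v = 0 | - h v = 1].
  move=> /hval[] ->; first by rewrite opprK; constructor 3.
    by rewrite oppr0; constructor 2.
  by constructor 1.
have nexch : exchange (fun v => - h v) X.
  move=> u v Xu Xv /eqP; rewrite eqr_oppLR => /eqP hu /eqP.
  rewrite eqr_opp => /eqP hv.
  have [v' [u' [Xv' Xu' hv' hu' e]]] := hexch Xv Xu hv hu.
  by exists v', u'; rewrite hv' hu' oppr0 addrC e.
have hx' : 0 <= - h x by rewrite oppr_ge0 ltW.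
have [m [c [v [c0 Xv c1 ->]]]] := conv_halfspace nhaff nval nexch Xx hx'.
exists m, c, (fun i => v i - h (v i) *: w); split=> // [i|].
  have [Xi hi] := Xv i.
  case: (hval Xi) => hv; rewrite hv.
  - by rewrite scaleN1r opprK; exact: hneg.
  - by rewrite scale0r subr0; apply: hpos => //; rewrite hv.
  - by move: hi; rewrite /= hv; lra.
have /= -> := haff v c1; rewrite scaler_suml -sumrB; apply: eq_bigr => i _.
by rewrite scalerBr scalerA.
Qed.

End TwoPieces.

(** The direction [w] is in the kernel of [h], so the inverse of the tropical map is
the tropical map of [- w] with the same form [h]; applying [conv_two_pieces] to
both maps gives the two inclusions. *)
Lemma two_piece_mutation (X X' : set V) (w : 'M[int]_(k, n)) (f : V) :
  let wR := map_mx intr w in let h := fun x => dotmx x f in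
  primitive_mx w -> f \is a mxOver Num.int -> dotmx wR f = 0 ->
  lattice_polytope (conv X) -> lattice_polytope (conv X') ->
  (forall v, X v \/ X' v -> [\/ h v = -1, h v = 0 | h v = 1]) ->
  exchange h X -> exchange h X' ->
  (forall v, 0 <= h v -> X v <-> X' v) ->
  (forall v, X v -> h v = -1 -> X' (v + wR)) ->
  (forall v, X' v -> h v = -1 -> X (v - wR)) ->
  combinatorial_mutation (conv X) (conv X').
Proof.
move=> wR h w1 fint wf lX lX' hval eX eX' hpos hneg hneg'.
have haff : affine (h : V -> R^o) by exact: dotmx_affine.
exists w, (conv [set` [:: 0; f]]); split=> //.
- split.
    exists [:: 0; f]; split=> // v; rewrite !inE => /orP[] /eqP -> //.
    by apply/mxOverP => i j; rewrite mxE rpred0.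
  move=> _ [m [c [v [c0 vF c1 ->]]]] /=.
  rewrite dotmxC; have -> := dotmx_affine wR v c1.
  apply: big1 => i _; rewrite dotmxC; have := vF i; rewrite /= !inE.
  by case/orP => /eqP ->; rewrite ?dotmx0 ?wf ?mulr0 // scaler0.
- apply/seteqP; split=> [y Xy|_ [x Xx <-]]; last first.
    rewrite tropical_map_segment; apply: (conv_two_pieces haff _ eX) => //.
    + by move=> v Xv; apply: hval; left.
    + by move=> v Xv hv; apply/(hpos _ hv).
  have hwy c : h (y - c *: wR) = h y.
    by rewrite /h -scaleNr dotmxDl dotmxZl wf mulr0 addr0.
  exists (y - Num.min 0 (h y) *: (- wR)).
    apply: (conv_two_pieces haff _ eX') => //.
    + by move=> v Xv; apply: hval; right.
    + by move=> v Xv hv; apply/(hpos _ hv).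
  rewrite tropical_map_segment -/(h _) scalerN opprK -[X in y + X]opprK -scaleNr hwy.
  by rewrite scaleNr opprK addrK.
Qed.

End TropicalMaps.

(** * Greedy matching fields *)

Section GreedyTuples.
Variables n : nat.
Implicit Types (kap : nat -> 'I_n -> nat).

(** The greedy filling of the rows, from the last one upwards, described without the
subset that is distributed; this turns exchanges of entries between tuples into
inequalities of keys. *)
Definition greedy k kap (j : 'I_k -> 'I_n) :=
  [forall p : 'I_k, forall q : 'I_k, (q < p)%N ==> (kap p (j q) < kap p (j p))%N].

Lemma greedyP k kap (j : 'I_k -> 'I_n) :
  reflect (forall p q : 'I_k, (q < p)%N -> (kap p (j q) < kap p (j p))%N)
          (greedy kap j).
Proof.
apply: (iffP forallP) => [H p q qp|H p].
  by move/forallP/(_ q): (H p); rewrite qp.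
by apply/forallP => q; apply/implyP; exact: H.
Qed.

Lemma greedy_inj k kap (j : 'I_k -> 'I_n) : greedy kap j -> injective j.
Proof.
move=> /greedyP H p q e; apply: val_inj.
by case: (ltngtP p q) => // /H; rewrite e ltnn.
Qed.

(** Filling the rows from the last one leaves no choice: row [p] must contain the
element with the largest key among those not used in later rows. *)
Lemma greedy_unique k kap (j j' : 'I_k -> 'I_n) : greedy kap j -> greedy kap j' ->
  (forall r, exists r', j r = j' r') -> (forall r, exists r', j' r = j r') ->
  j =1 j'.
Proof.
move=> vj vj' jj' j'j.
suff H d (p : 'I_k) : (k - p <= d)%N -> j p = j' p by move=> p; exact: H (leqnn _).
elim: d p => [|d IH] p; first by have := ltn_ord p; lia.
move=> kp; have le_p (l l' : 'I_k -> 'I_n) : greedy kap l -> greedy kap l' ->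
    (forall i : 'I_k, (p < i)%N -> l i = l' i) -> (forall r, exists r', l r = l' r') ->
    (kap p (l p) <= kap p (l' p))%N.
  move=> vl vl' ll' /(_ p) [r e]; have [rp|pr|rp] := ltngtP r p.
  - by rewrite e ltnW //; exact: (greedyP _ _ vl').
  - by move: e; rewrite -(ll' r pr) => /(greedy_inj vl) e; rewrite e ltnn in pr.
  - by rewrite e (val_inj rp).
have IH' (i : 'I_k) : (p < i)%N -> j i = j' i by move=> pi; apply: IH; lia.
have [r e] := jj' p; have [rp|pr|rp] := ltngtP r p.
- have := greedyP _ _ vj' p r rp; rewrite -e ltnNge.
  by rewrite (le_p _ _ vj' vj) // => i /IH' ->.
- by move: e; rewrite -(IH' r pr) => /(greedy_inj vj) e; rewrite e ltnn in pr.
- by rewrite e (val_inj rp).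
Qed.

Lemma greedy_exists k kap (A : {set 'I_n}) :
  (forall i, injective (kap i)) -> #|A| = k ->
  exists j : 'I_k -> 'I_n, greedy kap j /\ forall i, j i \in A.
Proof.
move=> kinj; elim: k A => [|k IH] A cA.
  have j : 'I_0 -> 'I_n by case.
  by exists j; split=> [|[]//]; apply/greedyP => -[].
have /card_gt0P[x0 Ax0] : (0 < #|A|)%N by rewrite cA.
pose x := [arg max_(x > x0 in A) kap k x]%N.
have [xA xmax] : x \in A /\ forall y, y \in A -> (kap k y <= kap k x)%N.
  by rewrite /x; case: arg_maxnP.
have cA' : #|A :\ x| = k by move: cA; rewrite (cardsD1 x) xA add1n => -[].
have [j [vj jA]] := IH _ cA'.
exists (fun i => if unlift ord_max i is Some i' then j i' else x); split.
  apply/greedyP => p q qp.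
  case: (unliftP ord_max q) => [q' eq|eq]; last first.
    by move: qp; rewrite eq /= ltnNge -ltnS ltn_ord.
  case: (unliftP ord_max p) => [p' ep|ep].
    have ep' : p = p' :> nat by rewrite ep lift_max.
    have eq' : q = q' :> nat by rewrite eq lift_max.
    by rewrite ep'; apply: (greedyP _ _ vj); rewrite -ep' -eq'.
  rewrite ep /= ltn_neqAle; have := jA q'; rewrite in_setD1 => /andP[nx /xmax ->].
  by rewrite andbT; apply: contra nx => /eqP /kinj ->.
move=> i; case: unlift => [i'|//].
by have := jA i'; rewrite in_setD1 => /andP[].
Qed.

End GreedyTuples.

Section GreedyField.
Variables (k n : nat).
Implicit Types (kap : nat -> 'I_n -> nat).

Definition subset_tuple (I : ksubset k n) (s : 'S_k) (r : 'I_k) : 'I_n :=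
  enum_val (cast_ord (esym (eqP (valP I))) (s r)).

(** The greedy tuple exists and is unique when the keys are injective
([greedy_exists], [greedy_unique]), so the default permutation does not occur and
the choice made by [pick] does not matter. *)
Definition greedy_mf kap : matching_field k n :=
  [ffun I => odflt 1%g [pick s | greedy kap (subset_tuple I s)]].

Lemma subset_tuple_surj (I : ksubset k n) (j : 'I_k -> 'I_n) :
  injective j -> (forall i, j i \in val I) -> exists s, subset_tuple I s =1 j.
Proof.
move=> jinj jI.
pose s r := cast_ord (eqP (valP I)) (enum_rank_in (jI r) (j r)).
have sK r : enum_val (cast_ord (esym (eqP (valP I))) (s r)) = j r.
  by rewrite /s cast_ordK enum_rankK_in.
have sinj : injective s by move=> r r' e; apply: jinj; rewrite -!sK e.
by exists (perm sinj) => r; rewrite /subset_tuple permE sK.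
Qed.

Lemma eq_greedy kap (j j' : 'I_k -> 'I_n) : j =1 j' -> greedy kap j = greedy kap j'.
Proof.
by move=> e; apply/eq_forallb => p; apply/eq_forallb => q; rewrite !e.
Qed.

Lemma greedy_mf_tuples kap : (forall i, injective (kap i)) ->
  forall I, greedy kap (mf_tuple (greedy_mf kap) I).
Proof.
move=> kinj I; rewrite /mf_tuple ffunE.
have [j [vj jI]] := greedy_exists kinj (eqP (valP I)).
have [s es] := subset_tuple_surj (greedy_inj vj) jI.
by case: pickP => [//|/(_ s)]; rewrite (eq_greedy _ es) vj.
Qed.

Lemma mf_tuple_mem (L : matching_field k n) I r : mf_tuple L I r \in val I.
Proof. exact: enum_valP. Qed.

Lemma mf_tuple_inj (L : matching_field k n) I : injective (mf_tuple L I).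
Proof. by move=> r r' /enum_val_inj /cast_ord_inj /perm_inj. Qed.

Lemma inj_img (j j' : 'I_k -> 'I_n) (A : {set 'I_n}) : #|A| = k ->
  injective j -> (forall i, j i \in A) -> (forall i, j' i \in A) ->
  forall r, exists r', j' r = j r'.
Proof.
move=> cA jinj jA j'A r.
have e : (j @: 'I_k) = A.
  apply/eqP; rewrite eqEcard cA card_imset // card_ord leqnn andbT.
  by apply/fintype.subsetP => _ /imsetP[i _ ->].
by have := j'A r; rewrite -e => /imsetP[r' _ ->]; exists r'.
Qed.

Lemma greedy_tuple_in kap (L : matching_field k n) (j : 'I_k -> 'I_n) :
  (forall I, greedy kap (mf_tuple L I)) -> greedy kap j ->
  exists I, mf_tuple L I =1 j.
Proof.
move=> vL vj; have jinj := greedy_inj vj.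
have cI : #|(j @: 'I_k)| == k by rewrite card_imset // card_ord.
pose I : ksubset k n := exist (fun A : {set 'I_n} => #|A| == k) _ cI; exists I.
have jI i : j i \in val I by apply: imset_f.
apply: (greedy_unique (vL I) vj).
  exact: (inj_img (eqP cI) jinj jI (mf_tuple_mem L I)).
exact: (inj_img (eqP cI) (@mf_tuple_inj L I) (mf_tuple_mem L I) jI).
Qed.

Definition tuple_point (R : realType) (j : 'I_k -> 'I_n) : 'M[R]_(k, n) :=
  \sum_(r < k) delta_mx r (j r).

Lemma tuple_pointE (R : realType) (j : 'I_k -> 'I_n) i c :
  tuple_point R j i c = (j i == c)%:R.
Proof.
rewrite summxE (bigD1 i) //= mxE eqxx /= big1 ?addr0 ?(eq_sym (j i)) //.
by move=> r ri; rewrite mxE eq_sym (negbTE ri).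
Qed.

Definition greedy_points (R : realType) kap : set 'M[R]_(k, n) :=
  [set x | exists2 j, greedy kap j & x = tuple_point R j].
Arguments greedy_points : clear implicits.

(** The vertices are the points of all greedy tuples, with no reference to the
subsets: a greedy tuple is the tuple of its own set of entries. *)
Lemma mf_polytopeE (R : realType) kap (L : matching_field k n) :
  (forall I, greedy kap (mf_tuple L I)) -> mf_polytope R L = conv (greedy_points R kap).
Proof.
move=> vL; rewrite /mf_polytope; congr conv; apply/seteqP; split.
  by move=> _ [I _ <-]; exists (mf_tuple L I).
move=> _ [j vj ->]; have [I e] := greedy_tuple_in vL vj.
by exists I => //; apply: eq_bigr => r _; rewrite e.
Qed.

Lemma mf_lattice (R : realType) (L : matching_field k n) : (k <= n)%N ->
  lattice_polytope (mf_polytope R L).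
Proof.
move=> kn; exists [seq mf_point R L J | J : ksubset k n]; split.
- have : (0 < #|{: ksubset k n}|)%N.
    have : (0 < #|[set A : {set 'I_n} | #|A| == k]%SET|)%N.
      by rewrite card_draws card_ord bin_gt0.
    case/card_gt0P => A; rewrite inE => cA.
    by apply/card_gt0P; exists (exist (fun A : {set 'I_n} => #|A| == k) A cA).
  by rewrite -size_eq0 size_image lt0n.
- move=> _ /mapP[I _ ->]; apply/mxOverP => i j.
  by rewrite (tuple_pointE R (mf_tuple L I)) rpred_nat.
- rewrite /mf_polytope; congr conv; apply/seteqP; split.
    by move=> _ [I _ <-]; apply/mapP; exists I; rewrite ?mem_enum.
  by move=> x /mapP[I _ ->]; exists I.
Qed.

Lemma diagonal_greedy I : greedy (fun _ (x : 'I_n) => val x) (mf_tuple (diagonal_mf k n) I).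
Proof.
by apply/greedyP => p q qp; apply: enum_val_ksubset_lt; rewrite !ffunE !perm1.
Qed.

End GreedyField.

Arguments greedy_points {k n} R kap.
Arguments greedy_mf {k n} kap.

(** * The mutation that exchanges two adjacent columns *)

Section AdjacentSwap.
Variables (k n : nat) (r q : 'I_k) (lo hi : pred 'I_n).
Hypothesis rq : q = r.+1 :> nat.
Implicit Types (kap : nat -> 'I_n -> nat) (a b : 'I_n).

Definition blocks a b (g : 'I_n -> nat) := forall x,
  (lo x -> (g x < g a)%N /\ (g x < g b)%N) /\
  (hi x -> (g a < g x)%N /\ (g b < g x)%N).

Definition covers a b := forall x, [\/ x = a, x = b, lo x | hi x].

(** What a row after [q] must satisfy for tails to be exchangeable: an entry
after [a] and [b] also exceeds [lo], and an entry that exceeds an element of [hi]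
also exceeds [a], [b] and [lo].  The predicate [D] restricts this to the columns
that can occur in the rows up to [q]. *)
Record tail_compatible (D : pred 'I_n) a b (g : 'I_n -> nat) := TailCompatible {
  tail_lo x : D x -> lo x -> (g x < g a)%N \/ (g x < g b)%N;
  tail_hi x z : D x -> D z -> [\/ x = a, x = b | lo x] -> hi z -> (g x < g z)%N }.

Lemma lt_rq : (r < q)%N. Proof. by rewrite rq. Qed.

Section OneSide.
Variables (kap : nat -> 'I_n -> nat) (a b : 'I_n).
Hypothesis cov : covers a b.
Hypothesis blr : blocks a b (kap r).
Hypothesis blq : blocks a b (kap q).
Hypothesis ab : (kap q a < kap q b)%N.

Lemma nlo_a : ~~ lo a.
Proof. by apply/negP => /(proj1 (blr a))[]; rewrite ltnn. Qed.
Lemma nlo_b : ~~ lo b.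
Proof. by apply/negP => /(proj1 (blr b))[_]; rewrite ltnn. Qed.
Lemma nhi_b : ~~ hi b.
Proof. by apply/negP => /(proj2 (blr b))[_]; rewrite ltnn. Qed.

Lemma lo_row (j : 'I_k -> 'I_n) (i : 'I_k) : greedy kap j -> lo (j r) ->
  (i <= r)%N -> lo (j i).
Proof.
move=> /greedyP vj jr; rewrite leq_eqVlt => /orP[/eqP/val_inj -> //|ir].
have := vj _ _ ir; have [ja jb] := proj1 (blr (j r)) jr.
have [->|->|//|/(proj2 (blr _))[]] := cov (j i); lia.
Qed.

Lemma swap_row (j : 'I_k -> 'I_n) (i : 'I_k) : greedy kap j -> j r = a -> j q = b ->
  (i < r)%N -> lo (j i).
Proof.
move=> vj ja jb ir; have := greedyP _ _ vj _ _ ir; rewrite ja.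
have [->|e|//|/(proj2 (blr _))[]] := cov (j i); try lia.
have : i = q by apply: (greedy_inj vj); rewrite e jb.
by move=> e'; move: ir; rewrite e' rq; lia.
Qed.

(** The key of row [q] puts the entry of row [r] before that of row [q]; if the former
is not in [lo] and the latter not in [hi], both are in the middle block, which
consists of [a] and [b]. *)
Lemma swapped_pair (j : 'I_k -> 'I_n) : greedy kap j -> ~~ lo (j r) -> ~~ hi (j q) ->
  j r = a /\ j q = b.
Proof.
move=> vj nlo nhi; have := greedyP _ _ vj _ _ lt_rq.
have [ea|eb|l|h] := cov (j r).
- have [->|-> //|l|h] := cov (j q); first by rewrite ea ltnn.
    by rewrite ea; have [] := proj1 (blq (j q)) l; lia.
  by rewrite h in nhi.
- have [->|->|l|h] := cov (j q); rewrite eb; try lia.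
  by have [] := proj1 (blq (j q)) l; lia.
- by rewrite l in nlo.
- have [] := proj2 (blq (j r)) h; have [->|->|l|h'] := cov (j q); try lia.
  by have [] := proj1 (blq (j q)) l; lia.
Qed.

Definition splice (j j' : 'I_k -> 'I_n) (i : 'I_k) : 'I_n := if (i <= r)%N then j i else j' i.

(** In the first splice the head lies in [lo], which the entry [b] of row [q] exceeds.
In the second one the head lies in [lo], [a] and [b], which the entry of row [q],
in [hi], exceeds.  For the rows after [q] this is [tail_compatible]. *)
Lemma splice_greedy (D : pred 'I_n) (j j' : 'I_k -> 'I_n) :
  (forall p : 'I_k, (q < p)%N -> tail_compatible D a b (kap p)) ->
  (forall l : 'I_k -> 'I_n, greedy kap l -> forall i : 'I_k, (i <= q)%N -> D (l i)) ->
  greedy kap j -> greedy kap j' -> lo (j r) -> hi (j q) -> j' r = a -> j' q = b ->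
  greedy kap (splice j j') /\ greedy kap (splice j' j).
Proof.
move=> tails inD vj vj' jr jq ja jb.
have splicing l l' : greedy kap l -> greedy kap l' ->
    (forall p i : 'I_k, (i <= r)%N -> (q <= p)%N -> (kap p (l i) < kap p (l' p))%N) ->
    greedy kap (splice l l').
  move=> vl vl' H; apply/greedyP => p i ip; rewrite /splice.
  case: (leqP p r) => pr; first by rewrite ifT; [exact: (greedyP _ _ vl) | lia].
  case: (leqP i r) => ir; last exact: (greedyP _ _ vl').
  by apply: H => //; rewrite rq.
split; apply: splicing => // p i ir.
- have li := lo_row vj jr ir.
  rewrite leq_eqVlt => /orP[/eqP/val_inj <-|qp].
    by rewrite jb; case: (proj1 (blq (j i)) li).
  have Di : D (j i) by apply: inD; rewrite // rq leqW.
  have := greedyP _ _ vj' _ _ qp; have := greedyP _ _ vj' _ _ (ltn_trans lt_rq qp).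
  by rewrite ja jb; case: (tail_lo (tails _ qp) Di li); lia.
- have xi : [\/ j' i = a, j' i = b | lo (j' i)].
    move: ir; rewrite leq_eqVlt => /orP[/eqP/val_inj ->|ir]; first by constructor 1.
    by constructor 3; apply: swap_row.
  rewrite leq_eqVlt => /orP[/eqP/val_inj <-|qp].
    have [_ /(_ jq)[h1 h2]] := blq (j q).
    case: xi => [->|->|/(proj1 (blq _))[]] //; lia.
  apply: (ltn_trans _ (greedyP _ _ vj _ _ qp)).
  by apply: (tail_hi (tails _ qp)) => //; apply: inD; rewrite // rq leqW.
Qed.

Definition swap (j : 'I_k -> 'I_n) (i : 'I_k) : 'I_n :=
  if i == r then j q else if i == q then j r else j i.

Section Modified.
Variable kap' : nat -> 'I_n -> nat.
Hypothesis same : forall i, i != q :> nat -> kap' i = kap i.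

Lemma swap_greedy (j : 'I_k -> 'I_n) : blocks a b (kap' q) ->
  (kap' q b < kap' q a)%N -> greedy kap j -> j r = a -> j q = b ->
  greedy kap' (swap j).
Proof.
move=> blq' ba vj ja jb; have vP := greedyP _ _ vj.
have nrq : q != r by rewrite -val_eqE /= rq; lia.
apply/greedyP => p i ip; rewrite {2}/swap; case: eqP => [pr|/eqP pr].
  have ir : (i < r)%N by rewrite -pr.
  rewrite same; last by rewrite pr; have := lt_rq; lia.
  have -> : swap j i = j i.
    by rewrite /swap !ifF //; apply/eqP => e; move: ir; rewrite e ?rq; lia.
  by rewrite jb pr; case: (proj1 (blr _) (swap_row vj ja jb ir)).
case: eqP => [pq|/eqP pq].
  rewrite /swap pq; case: eqP => [ir|/eqP ir]; first by rewrite jb ja.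
  have ir' : (i < r)%N by move: ip ir; rewrite pq rq -val_eqE /=; lia.
  rewrite ifF; last by apply/eqP => e; move: ir'; rewrite e rq; lia.
  by rewrite ja; case: (proj1 (blq' _) (swap_row vj ja jb ir')).
rewrite same //; case: (ltnP q p) => qp.
  rewrite /swap; case: eqP => _; first exact: vP.
  by case: eqP => _; apply: vP => //; apply: ltn_trans lt_rq qp.
have pr' : (p < r)%N by move: qp pr pq; rewrite -!val_eqE /= rq; lia.
rewrite /swap !ifF; first exact: vP.
  by apply/eqP => e; move: ip; rewrite e rq; lia.
by apply/eqP => e; move: ip; rewrite e; lia.
Qed.

(** Only the inversion of [a] and [b] in row [q] could fail under the new key, that is
[b] in row [q] and [a] in an earlier row.  If [a] is in row [r], then the two
columns lie in neither [lo] nor [hi].  If [a] is before row [r], the entry of row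
[r] exceeds [a] for the key of row [r] and is less than [b] for that of row [q],
but no column lies between [a] and [b]. *)
Lemma unswapped_greedy (j : 'I_k -> 'I_n) :
  (forall x y, ~~ ((x == a) && (y == b)) ->
    (kap q x < kap q y)%N -> (kap' q x < kap' q y)%N) ->
  greedy kap j -> lo (j r) || hi (j q) ->
  greedy kap' j.
Proof.
move=> agree vj lh; have vP := greedyP _ _ vj; apply/greedyP => p i ip.
case: (eqVneq (p : nat) q) => [/val_inj pq|pq]; last by rewrite same //; exact: vP.
move: ip; rewrite {}pq => iq; apply: agree; last exact: vP.
apply/negP => /andP[/eqP ja /eqP jb].
move: iq; rewrite rq ltnS leq_eqVlt => /orP[/eqP/val_inj ir|ir].
  by move: lh; rewrite -ir ja jb (negbTE nlo_a) (negbTE nhi_b).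
have := vP _ _ lt_rq; have := vP _ _ ir; rewrite ja jb.
have [->|->|/(proj1 (blr _))[]|/(proj2 (blq _))[]] := cov (j r); lia.
Qed.

End Modified.
End OneSide.

Variables (R : realType).
Local Notation V := 'M[R]_(k, n).

(** As a linear form, this takes the value -1 on a greedy tuple exactly when the rows
[r] and [q] of the tuple contain [a] and [b], see [swapped_pair]. *)
Definition swap_factor : V := \matrix_(i, c)
  ((i == q)%:R * (hi c)%:R - (i == r)%:R * (~~ lo c)%:R).

Definition swap_dir a b : 'M[int]_(k, n) := \matrix_(i, c)
  (((i == r)%:R - (i == q)%:R) * ((c == b)%:R - (c == a)%:R)).

Lemma neq_rq : (r == q) = false.
Proof. by apply/eqP => e; have := rq; rewrite -e; lia. Qed.

Lemma dot_tuple_point (j : 'I_k -> 'I_n) (f : V) :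
  dotmx (tuple_point R j) f = \sum_i f i (j i).
Proof.
apply: eq_bigr => i _; rewrite (bigD1 (j i)) //= tuple_pointE eqxx mul1r big1 ?addr0 //.
by move=> c cj; rewrite tuple_pointE eq_sym (negbTE cj) mul0r.
Qed.

Lemma dot_swap_factor (j : 'I_k -> 'I_n) :
  dotmx (tuple_point R j) swap_factor = (hi (j q))%:R - (~~ lo (j r))%:R.
Proof.
rewrite dot_tuple_point (bigD1 r) //= (bigD1 q) /= ?(eq_sym q) ?neq_rq // big1 => [|i].
  rewrite !mxE !eqxx neq_rq [q == r]eq_sym neq_rq /=.
  by rewrite !(mul0r, mul1r) sub0r subr0 addr0 addrC.
by case/andP => ir iq; rewrite mxE (negbTE ir) (negbTE iq) !mul0r subr0.
Qed.

Lemma swap_dir_primitive a b : a != b -> primitive_mx (swap_dir a b).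
Proof.
move=> nab; rewrite /primitive_mx (bigD1 r) //= (bigD1 b) //=.
rewrite mxE !eqxx neq_rq eq_sym (negbTE nab) !subr0 mulr1 /=.
by rewrite !gcd1n.
Qed.

Lemma dot_swap_dir a b : a != b -> ~~ lo a -> ~~ lo b -> ~~ hi a -> ~~ hi b ->
  dotmx (map_mx intr (swap_dir a b)) swap_factor = 0 :> R.
Proof.
move=> nab la lb ha hb.
have E i c : (map_mx intr (swap_dir a b) : V) i c =
    ((i == r)%:R - (i == q)%:R) * ((c == b)%:R - (c == a)%:R).
  by rewrite !mxE rmorphM !rmorphB /= !natz.
apply: big1 => i _; rewrite (bigD1 a) //= (bigD1 b) ?(eq_sym b) //= big1 => [|c /andP[ca cb]].
  rewrite !E !mxE !eqxx [b == a]eq_sym (negbTE nab).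
  by rewrite (negbTE la) (negbTE lb) (negbTE ha) (negbTE hb) /=; ring.
by rewrite E (negbTE ca) (negbTE cb) subrr mulr0 mul0r.
Qed.

Lemma swap_point a b (j : 'I_k -> 'I_n) : j r = a -> j q = b ->
  tuple_point R (swap j) = tuple_point R j + map_mx intr (swap_dir a b).
Proof.
move=> ja jb; apply/matrixP => i c; rewrite [RHS]mxE !tuple_pointE !mxE.
rewrite rmorphM !rmorphB /= !natz /swap [c == b]eq_sym [c == a]eq_sym.
have [->|_] := eqVneq i r; first by rewrite neq_rq ja jb /=; ring.
by have [->|_] := eqVneq i q; rewrite ?ja ?jb /=; ring.
Qed.

Lemma splice_point (j j' : 'I_k -> 'I_n) :
  tuple_point R j + tuple_point R j'
  = tuple_point R (splice j j') + tuple_point R (splice j' j).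
Proof.
rewrite /tuple_point -!big_split; apply: eq_bigr => i _ /=.
by rewrite /splice; case: ifP => // _; rewrite addrC.
Qed.

Section Mutation.
Variables (kap kap' : nat -> 'I_n -> nat) (a b : 'I_n) (D : pred 'I_n).
Hypothesis same : forall i, i != q :> nat -> kap' i = kap i.
Hypothesis cov : covers a b.
Hypothesis blr : blocks a b (kap r).
Hypothesis blq : blocks a b (kap q).
Hypothesis blq' : blocks a b (kap' q).
Hypothesis ab : (kap q a < kap q b)%N.
Hypothesis ba : (kap' q b < kap' q a)%N.
Hypothesis agree : forall x y, ~~ ((x == a) && (y == b)) -> ~~ ((x == b) && (y == a)) ->
  (kap q x < kap q y)%N = (kap' q x < kap' q y)%N.
Hypothesis tails : forall p : 'I_k, (q < p)%N -> tail_compatible D a b (kap p).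
Hypothesis inD : forall j : 'I_k -> 'I_n, greedy kap j \/ greedy kap' j ->
  forall i : 'I_k, (i <= q)%N -> D (j i).

Let h (x : V) := dotmx x swap_factor.

Lemma h_neg (j : 'I_k -> 'I_n) : h (tuple_point R j) = -1 -> ~~ lo (j r) /\ ~~ hi (j q).
Proof.
by rewrite /h dot_swap_factor; case: (lo _); case: (hi _) => /=; [lra | lra | lra |].
Qed.

Lemma h_pos (j : 'I_k -> 'I_n) : h (tuple_point R j) = 1 -> lo (j r) /\ hi (j q).
Proof.
by rewrite /h dot_swap_factor; case: (lo _); case: (hi _) => /=; [|lra | lra | lra].
Qed.

Lemma h_nneg (j : 'I_k -> 'I_n) : 0 <= h (tuple_point R j) -> lo (j r) || hi (j q).
Proof.
by rewrite /h dot_swap_factor; case: (lo _); case: (hi _) => //=; lra.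
Qed.

(** The hypotheses are symmetric under exchanging [kap], [a] with [kap'], [b], so the
facts about [kap] also serve for the inverse mutation. *)
Lemma adjacent_swap_mutation :
  lattice_polytope (conv (greedy_points R kap : set V)) ->
  lattice_polytope (conv (greedy_points R kap' : set V)) ->
  combinatorial_mutation (conv (greedy_points R kap : set V))
    (conv (greedy_points R kap' : set V)).
Proof.
move=> lX lX'.
have nab : a != b by apply: contraTneq ab => ->; rewrite ltnn.
have covC : covers b a.
  by move=> x; case: (cov x); [constructor 2|constructor 1|constructor 3|constructor 4].
have blC g : blocks a b g -> blocks b a g.
  by move=> bl x; have [H1 H2] := bl x; split=> [/H1|/H2] [].
have same' i : i != q :> nat -> kap i = kap' i by move=> /same.
have kapr : kap' r = kap r by apply: same; rewrite rq; lia.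
have agreeC x y : ~~ ((x == b) && (y == a)) ->
    (kap' q x < kap' q y)%N -> (kap q x < kap q y)%N.
  move=> H; have [/andP[/eqP -> /eqP ->] //|H'] := boolP ((x == a) && (y == b)).
  by rewrite agree.
have agree1 x y : ~~ ((x == a) && (y == b)) ->
    (kap q x < kap q y)%N -> (kap' q x < kap' q y)%N.
  move=> H; have [/andP[/eqP -> /eqP ->] //|H'] := boolP ((x == b) && (y == a)).
  by rewrite agree.
have tailsC (p : 'I_k) : (q < p)%N -> tail_compatible D b a (kap' p).
  move=> qp; rewrite same; last by lia.
  have [T1 T2] := tails qp; split=> [x Dx lx|x z Dx Dz xab].
    by case: (T1 x Dx lx); [right | left].
  by apply: T2 => //; case: xab; [constructor 2|constructor 1|constructor 3].
have inD1 j : greedy kap j -> forall i : 'I_k, (i <= q)%N -> D (j i).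
  by move=> vj; apply: inD; left.
have inD2 j : greedy kap' j -> forall i : 'I_k, (i <= q)%N -> D (j i).
  by move=> vj; apply: inD; right.
have blr' : blocks b a (kap' r) by rewrite kapr; exact: blC.
have la := nlo_a blr; have lb := nlo_b blr; have hb := nhi_b blr.
have ha := nhi_b blr'.
have hsplice l l' u u' (vl : lo (l r)) (hl : hi (l q)) : ~~ lo u -> ~~ hi u' ->
    l' r = u -> l' q = u' ->
    h (tuple_point R (splice l l')) = 0 /\ h (tuple_point R (splice l' l)) = 0.
  move=> lu hu eu eu'; rewrite /h !dot_swap_factor /splice leqnn rq ltnn.
  by rewrite vl hl eu eu' lu (negbTE hu) subrr subrr.
apply: (two_piece_mutation (w := swap_dir a b) (f := swap_factor)) => //.
- exact: swap_dir_primitive.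
- apply/mxOverP => i c; rewrite mxE.
  by apply: rpredB; apply: rpredM; exact: rpred_nat.
- exact: dot_swap_dir.
- have key j : [\/ h (tuple_point R j) = -1, h (tuple_point R j) = 0
      | h (tuple_point R j) = 1].
    rewrite /h dot_swap_factor; case: (lo _); case: (hi _) => /=.
    + by constructor 3; lra.
    + by constructor 2; lra.
    + by constructor 2; lra.
    + by constructor 1; lra.
  by move=> v [] [j _ ->]; exact: key.
- move=> _ _ [j vj ->] [j' vj' ->] /h_pos[l1 h1] /h_neg[l2 h2].
  have [ja jb] := swapped_pair cov blq ab vj' l2 h2.
  have [v1 v2] := splice_greedy cov blr blq ab tails inD1 vj vj' l1 h1 ja jb.
  have [s1 s2] := hsplice _ _ _ _ l1 h1 la hb ja jb.
  exists (tuple_point R (splice j j')), (tuple_point R (splice j' j)).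
  by split=> //; [exists (splice j j') | exists (splice j' j) | exact: splice_point].
- move=> _ _ [j vj ->] [j' vj' ->] /h_pos[l1 h1] /h_neg[l2 h2].
  have [ja jb] := swapped_pair covC (blC _ blq') ba vj' l2 h2.
  have [v1 v2] := splice_greedy covC blr' (blC _ blq') ba tailsC inD2 vj vj' l1 h1 ja jb.
  have [s1 s2] := hsplice _ _ _ _ l1 h1 lb ha ja jb.
  exists (tuple_point R (splice j j')), (tuple_point R (splice j' j)).
  by split=> //; [exists (splice j j') | exists (splice j' j) | exact: splice_point].
- move=> v hv; split=> -[j vj e]; exists j => //; rewrite e in hv.
    exact: (unswapped_greedy cov blr blq ab same agree1 vj (h_nneg hv)).
  exact: (unswapped_greedy covC blr' (blC _ blq') ba same' agreeC vj (h_nneg hv)).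
- move=> _ [j vj ->] /h_neg[l2 h2].
  have [ja jb] := swapped_pair cov blq ab vj l2 h2.
  rewrite -(swap_point ja jb); exists (swap j) => //.
  exact: (swap_greedy cov blr ab same blq' ba).
- move=> _ [j vj ->] /h_neg[l2 h2].
  have [ja jb] := swapped_pair covC (blC _ blq') ba vj l2 h2.
  exists (swap j).
    exact: (swap_greedy covC blr' ba same' (blC _ blq) ab).
  rewrite (swap_point ja jb); congr (_ + _); apply/matrixP => i c.
  by rewrite !mxE !rmorphM !rmorphB /= !natz; ring.
Qed.

End Mutation.
End AdjacentSwap.

(** * Sorting a block of rows by mutations *)

Section Paths.
Variables (R : realType) (k n : nat).
Implicit Types (L : matching_field k n) (f g : 'I_n -> nat) (kap rho : nat -> 'I_n -> nat).

Definition mutation_path L L' := exists (s : nat) (P : nat -> matching_field k n),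
  [/\ P 0%N = L, P s = L' & forall i : nat, (1 <= i <= s)%N ->
      combinatorial_mutation (mf_polytope R (P i.-1)) (mf_polytope R (P i))].

Lemma mutation_path_refl L : mutation_path L L.
Proof. by exists 0%N, (fun=> L); split=> // i; lia. Qed.

Lemma mutation_path_step L L' :
  combinatorial_mutation (mf_polytope R L) (mf_polytope R L') -> mutation_path L L'.
Proof.
move=> H; exists 1%N, (fun i => if i == 0%N then L else L'); split=> // i i1.
by have -> : i = 1%N by lia.
Qed.

Lemma mutation_path_trans L1 L2 L3 :
  mutation_path L1 L2 -> mutation_path L2 L3 -> mutation_path L1 L3.
Proof.
move=> [s [P [P0 Ps HP]]] [s' [P' [P0' Ps' HP']]].
exists (s + s')%N, (fun i => if (i <= s)%N then P i else P' (i - s)%N); split=> //.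
  case: ifP => [ss|_]; last by rewrite addKn.
  have s0 : s' = 0%N by lia.
  by rewrite s0 addn0 Ps -P0' -Ps' s0.
move=> i /andP[i1 is_]; have [le_is|lt_si] := leqP i s.
  by rewrite ifT; [apply: HP; rewrite i1 | lia].
have [le_is|lt_si'] := leqP i.-1 s; last first.
  have -> : (i.-1 - s = (i - s).-1)%N by lia.
  by apply: HP'; lia.
have is1 : i.-1 = s by lia.
have -> : (i - s = 1)%N by lia.
by rewrite is1 Ps -P0'; apply: (HP' 1%N); lia.
Qed.

(** Row 0 is filled last, with the only element left, so its key has no influence. *)
Lemma eq_greedy_mf kap kap' :
  (forall p x y, (0 < p < k)%N -> (kap p x < kap p y)%N = (kap' p x < kap' p y)%N) ->
  greedy_mf kap = greedy_mf kap' :> matching_field k n.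
Proof.
move=> e; apply/ffunP => I; rewrite !ffunE; congr odflt; apply: eq_pick => s.
apply/eq_forallb => p; apply/eq_forallb => q.
have [qp|//] := boolP (q < p)%N; rewrite !implyTb e //.
by rewrite ltn_ord andbT (leq_trans _ qp).
Qed.

Definition first_rows M f rho (i : nat) : 'I_n -> nat := if (i < M)%N then f else rho i.

(** The keys of the rows before [M] change while they are sorted, so the bound [D] on
their entries must only rest on the later rows. *)
Definition occurs_below M rho (D : pred 'I_n) := forall kap,
  (forall i, (M <= i)%N -> kap i = rho i) -> forall j : 'I_k -> 'I_n, greedy kap j ->
  forall i : 'I_k, (i < M)%N -> D (j i).

Section AdjacentTransposition.
Variables (M : nat) (rho : nat -> 'I_n -> nat) (f : 'I_n -> nat) (a b : 'I_n).
Variable D : pred 'I_n.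
Hypothesis kn : (k <= n)%N.
Hypothesis Mk : (M <= k)%N.
Hypothesis rho_inj : forall i, injective (rho i).
Hypothesis f_inj : injective f.
Hypothesis ab : (f a < f b)%N.
Hypothesis adj : forall x, ~~ (f a < f x < f b)%N.
Hypothesis tails : forall p, (M <= p < k)%N ->
  tail_compatible (fun x => f x < f a)%N (fun x => f b < f x)%N D a b (rho p).
Hypothesis inD : occurs_below M rho D.

Let f' x := f (tperm a b x).
Let lo : pred 'I_n := fun x => (f x < f a)%N.
Let hi : pred 'I_n := fun x => (f b < f x)%N.
Let stage c i := if (i < c)%N then f' else first_rows M f rho i.

Lemma transposition_covers : covers lo hi a b.
Proof.
move=> x; case: (ltngtP (f x) (f a)) => [h|h|/f_inj ->].
- by constructor 3.
- case: (ltngtP (f x) (f b)) => [h'|h'|/f_inj ->].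
  + by have := adj x; rewrite h h'.
  + by constructor 4.
  + by constructor 2.
- by constructor 1.
Qed.

Lemma transposed_other x : lo x || hi x -> f' x = f x.
Proof.
by rewrite /f' /lo /hi; case: tpermP => // ->; lia.
Qed.

(** For [c = 0] only the key of row 0 changes and the field stays the same; otherwise
this is the elementary mutation for the rows [c - 1] and [c]. *)
Lemma transposition_stage c : (c < M)%N ->
  mutation_path (greedy_mf (stage c)) (greedy_mf (stage c.+1)).
Proof.
have f'_inj : injective f' by move=> x y /f_inj /perm_inj.
have stage_inj l i : injective (stage l i).
  by rewrite /stage /first_rows; case: ifP => // _; case: ifP.
case: c => [|c] cM.
  have -> : greedy_mf (stage 0) = greedy_mf (stage 1) :> matching_field k n.
    by apply: eq_greedy_mf => -[|p].
  exact: mutation_path_refl.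
have ck : (c < k)%N by lia.
have ck' : (c.+1 < k)%N by lia.
pose r := Ordinal ck; pose q := Ordinal ck'.
have bl : blocks lo hi a b f by move=> x; rewrite /lo /hi; split; lia.
have f'a : f' a = f b by rewrite /f' tpermL.
have f'b : f' b = f a by rewrite /f' tpermR.
have bl' : blocks lo hi a b f'.
  move=> x; split=> h; rewrite (transposed_other (x := x)) ?h ?orbT // f'a f'b;
    by move: h; rewrite /lo /hi; lia.
have stq : stage c.+1 q = f by rewrite /stage /first_rows /= ltnn cM.
have stq' : stage c.+2 q = f' by rewrite /stage /= leqnn.
apply: mutation_path_step.
have lat kap : (forall i, injective (kap i)) ->
    lattice_polytope (conv (greedy_points R kap : set 'M[R]_(k, n))).
  by move=> ki; rewrite -(mf_polytopeE R (greedy_mf_tuples ki)); exact: mf_lattice.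
rewrite !(mf_polytopeE R (greedy_mf_tuples (stage_inj _))).
apply: (@adjacent_swap_mutation k n r q lo hi _ R _ _ a b D) => //; try exact: lat.
- by move=> i iq; rewrite /stage ltnS leq_eqVlt (negbTE iq).
- exact: transposition_covers.
- by rewrite /stage /= leqnn.
- by rewrite stq.
- by rewrite stq'.
- by rewrite stq.
- by rewrite stq' f'a f'b.
- move=> x y; rewrite stq stq'.
  have [xa|xa] := eqVneq x a; have [ya|ya] := eqVneq y a.
  + by rewrite xa ya !ltnn.
  + have [//|yb] := eqVneq y b.
    have := transposition_covers y; rewrite xa f'a => -[] e; rewrite ?e ?eqxx // in ya yb *.
      by rewrite transposed_other ?e //; move: e; rewrite /lo; lia.
    by rewrite transposed_other ?e ?orbT //; move: e; rewrite /hi; lia.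
  + have [//|xb] := eqVneq x b.
    have := transposition_covers x; rewrite ya f'a => -[] e; rewrite ?e ?eqxx // in xa xb *.
      by rewrite transposed_other ?e //; move: e; rewrite /lo; lia.
    by rewrite transposed_other ?e ?orbT //; move: e; rewrite /hi; lia.
  + have [xb|xb] := eqVneq x b; have [yb|yb] := eqVneq y b.
    * by rewrite xb yb !ltnn.
    * have := transposition_covers y; rewrite xb f'b => -[] e; rewrite ?e ?eqxx // in ya yb *.
        by rewrite transposed_other ?e //; move: e; rewrite /lo; lia.
      by rewrite transposed_other ?e ?orbT //; move: e; rewrite /hi; lia.
    * have := transposition_covers x; rewrite yb f'b => -[] e; rewrite ?e ?eqxx // in xa xb *.
        by rewrite transposed_other ?e //; move: e; rewrite /lo; lia.
      by rewrite transposed_other ?e ?orbT //; move: e; rewrite /hi; lia.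
    * by rewrite /f' !tpermD // eq_sym.
- move=> p qp; rewrite /stage /first_rows ltnNge ltnW //=; case: ltnP => pM.
    split=> [x _ lx|x z _ _ xab hz]; first by left.
    by move: hz; rewrite /hi; case: xab => [->|->|]; rewrite /lo; lia.
  by apply: tails; rewrite pM ltn_ord.
- move=> j vj i iq.
  have iM : (i < M)%N by apply: leq_trans cM.
  have H l : (l <= M)%N -> forall i, (M <= i)%N -> stage l i = rho i.
    by move=> lM i' Mi; rewrite /stage /first_rows !ifF //; lia.
  case: vj => vj.
    exact: (inD (H c.+1 (ltnW cM)) vj).
  exact: (inD (H c.+2 cM) vj).
Qed.

Lemma transposition_path :
  mutation_path (greedy_mf (first_rows M f rho) : matching_field k n)
    (greedy_mf (first_rows M f' rho)).
Proof.
have H c : (c <= M)%N -> mutation_path (greedy_mf (stage 0)) (greedy_mf (stage c)).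
  elim: c => [|c IH] cM; first exact: mutation_path_refl.
  exact: mutation_path_trans (IH (ltnW cM)) (transposition_stage cM).
have -> : greedy_mf (first_rows M f' rho) = greedy_mf (stage M) :> matching_field k n.
  apply: eq_greedy_mf => p x y _; rewrite /stage /first_rows.
  by case: (p < M)%N.
exact: H.
Qed.

End AdjacentTransposition.

Section BubbleSort.
Variables (M : nat) (rho : nat -> 'I_n -> nat) (tau : 'I_n -> nat) (D : pred 'I_n).
Hypothesis kn : (k <= n)%N.
Hypothesis Mk : (M <= k)%N.
Hypothesis rho_inj : forall i, injective (rho i).
Hypothesis tau_inj : injective tau.
Hypothesis inD : occurs_below M rho D.

(** The order relations that can appear while [f] is sorted into [tau]: bubble sort
only ever inverts pairs on which [f] and [tau] disagree. *)
Definition either_lt f (x y : 'I_n) := (f x < f y)%N || (tau x < tau y)%N.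

(** This form of compatibility is inherited by every key met during the sorting,
because it only refers to the relations of [either_lt]. *)
Definition sortable f := forall a b, (f a < f b)%N -> (tau b < tau a)%N ->
  forall p, (M <= p < k)%N ->
  tail_compatible (fun x => either_lt f x a && either_lt f x b)
    (fun x => either_lt f a x && either_lt f b x) D a b (rho p).

Definition inversions f :=
  [set xy : 'I_n * 'I_n | (f xy.1 < f xy.2)%N && (tau xy.2 < tau xy.1)%N]%SET.

Lemma sort_path f : injective f -> sortable f ->
  mutation_path (greedy_mf (first_rows M f rho)) (greedy_mf (first_rows M tau rho)).
Proof.
have [m] := ubnP #|inversions f|; elim: m f => // m IH f invm f_inj sf.
have [inv0|[[a0 b0] inv0]] := set_0Vmem (inversions f).
  have -> : greedy_mf (first_rows M f rho)
      = greedy_mf (first_rows M tau rho) :> matching_field k n.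
    apply: eq_greedy_mf => p x y _; rewrite /first_rows; case: ifP => // _.
    have ninv u v : (f u < f v)%N -> (tau v < tau u)%N = false.
      move=> uv; apply/negP => vu.
      by have : (u, v) \in inversions f; [rewrite inE /= uv | rewrite inv0 inE].
    have [e|nxy] := eqVneq x y; first by rewrite e !ltnn.
    have := ninv x y; have := ninv y x.
    have : f x != f y by apply: contra nxy => /eqP/f_inj ->.
    have : tau x != tau y by apply: contra nxy => /eqP/tau_inj ->.
    by move: (f x) (f y) (tau x) (tau y) => u v u' v'; lia.
  exact: mutation_path_refl.
(* for an inverted pair that is closest for f, a column between the two would
   form a closer inverted pair with one of them; so the pair is adjacent *)
pose c (xy : 'I_n * 'I_n) := (f xy.2 - f xy.1)%N.
case: (@arg_minnP _ (a0, b0) (fun xy => xy \in inversions f) c inv0) => -[a b] /=.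
rewrite inE /= => /andP[ab ba] cmin.
have adj x : ~~ (f a < f x < f b)%N.
  apply/negP => /andP[ax xb].
  have [xa|ax'] := ltnP (tau x) (tau a).
    have := cmin (a, x); rewrite inE /= ax xa /c /= => /(_ isT); lia.
  have := cmin (x, b); rewrite inE /= xb (leq_trans ba ax') /c /= => /(_ isT); lia.
pose f' x := f (tperm a b x).
have f'_lt x y : (f' x < f' y)%N -> (f x < f y)%N \/ (x = b /\ y = a).
  have cv := transposition_covers f_inj adj.
  rewrite /f'; case: tpermP => [->|->|/eqP xa /eqP xb];
    case: tpermP => [->|->|/eqP ya /eqP yb]; try lia.
  - by right.
  - by have := cv y => -[] e; rewrite ?e ?eqxx // in ya yb *; lia.
  - by have := cv x => -[] e; rewrite ?e ?eqxx // in xa xb *; lia.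
have f'_either x y : either_lt f' x y -> either_lt f x y.
  rewrite /either_lt => /orP[/f'_lt[->//|[-> ->]]|->]; rewrite ?ba ?orbT //.
apply: (@mutation_path_trans _ (greedy_mf (first_rows M f' rho))).
  apply: (@transposition_path M rho f a b D) => // p Mp.
  have [T1 T2] := sf a b ab ba p Mp; split=> [x Dx lx|x z Dx Dz xab hz].
    by apply: T1 => //; rewrite /either_lt lx (ltn_trans lx ab).
  apply: T2 => //; last by rewrite /either_lt hz (ltn_trans ab hz).
  case: xab => [->|->|lx]; [by constructor 1 | by constructor 2 | constructor 3].
  by rewrite /either_lt lx (ltn_trans lx ab).
apply: IH.
- rewrite -ltnS (leq_trans _ invm) // ltnS; apply: proper_card.
  apply/properP; split.
    apply/fintype.subsetP => -[x y]; rewrite !inE /= => /andP[/f'_lt[->//|[-> ->]]].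
    by rewrite ltnNge ltnW.
  exists (a, b); rewrite inE /= ?ab // /f' tpermL tpermR ltnNge ltnW //.
- by move=> x y /f_inj /perm_inj.
- move=> x y xy' yx p Mp.
  case: (f'_lt _ _ xy') => [xy|[ex ey]]; last by move: yx; rewrite ex ey; lia.
  have [T1 T2] := sf x y xy yx p Mp; split=> [u Du /andP[ux uy]|u z Du Dz uxy /andP[xz yz]].
    by apply: T1 => //; rewrite !f'_either.
  apply: T2 => //; last by rewrite !f'_either.
  case: uxy => [->|->|/andP[ux uy]]; [by constructor 1 | by constructor 2 | constructor 3].
  by rewrite !f'_either.
Qed.

End BubbleSort.
End Paths.

(** * From the diagonal field to the FFLV field *)

Section FFLVKeys.
Variables (R : realType) (k n : nat).
Hypothesis kn : (k < n)%N.

(** Increasing in this order: the columns before [m], the columns from [n - 1] down to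
[k], the columns from [m] to [k - 1]. *)
Definition fflv_key (m : nat) (x : 'I_n) : nat :=
  if (x < m)%N then (x : nat) else if (x < k)%N then (n.*2 + x)%N else (n.*2 - x)%N.

Lemma fflv_key_inj m : injective (fflv_key m).
Proof.
move=> x y e; apply: val_inj; move: e; rewrite /fflv_key /=.
have := ltn_ord x; have := ltn_ord y.
by case: (ltnP x m); case: (ltnP y m); case: (ltnP x k); case: (ltnP y k); lia.
Qed.

Lemma greedy_mf_unique kap (L : matching_field k n) :
  (forall i, injective (kap i)) -> (forall I, greedy kap (mf_tuple L I)) ->
  L = greedy_mf kap.
Proof.
move=> ki vL; apply/ffunP => I; apply/permP => r.
have := greedy_mf_tuples (k := k) ki I => vG.
have cI := eqP (valP I).
have : mf_tuple L I r = mf_tuple (greedy_mf kap) I r.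
  apply: (greedy_unique (vL I) vG).
    exact: (inj_img cI (@mf_tuple_inj _ _ _ I) (mf_tuple_mem _ I) (mf_tuple_mem _ I)).
  exact: (inj_img cI (@mf_tuple_inj _ _ _ I) (mf_tuple_mem _ I) (mf_tuple_mem _ I)).
by move=> /enum_val_inj /cast_ord_inj.
Qed.

(** If a column [c] with [m < c < k] were in a row [i <= m], then row [c] would have to
contain a column that precedes [k] and exceeds [c]; this column is again in a row
of smaller index than itself, and the ascent cannot end. *)
Lemma fflv_occurs m : (m < k)%N ->
  occurs_below k m.+1 fflv_key (fun x => ~~ (m < x < k)%N).
Proof.
move=> mk kap rows j vj i im; apply/negP => /andP[mj jk].
have {im} : (i < j i)%N by apply: leq_trans im _.
have [d] := ubnP (k - j i)%N; elim: d i mj jk => // d IH i mj jk kd ij.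
pose c := Ordinal jk.
have := greedyP _ _ vj c i ij; rewrite rows //= /fflv_key /=.
rewrite ltnn jk => H.
have [c1 c2] : (j i < j c)%N /\ (j c < k)%N.
  by move: H; case: (ltnP (j c) (j i)); case: (ltnP (j c) k); have := ltn_ord (j c); lia.
by apply: (IH c) => //=; [exact: ltn_trans mj c1 | lia].
Qed.

(** Among the columns that can occur in the rows up to [m], the keys [fflv_key m.+1]
and [fflv_key m] only disagree on pairs of [m] and a column [b >= k].  Around such
a pair, [lo] consists of columns before [m] and columns after [b], and [hi] of the
columns from [k] to [b - 1]; for the later rows too, [b] comes after [lo], and [hi]
after all of these and [m]. *)
Lemma fflv_sortable m : (m < k)%N ->
  sortable k m.+1 fflv_key (fflv_key m) (fun x => ~~ (m < x < k)%N) (fflv_key m.+1).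
Proof.
move=> mk a b ab ba p /andP[mp pk].
have nx := @ltn_ord n.
have [am bk] : (a = m :> nat) /\ (k <= b)%N.
  move: ab ba; rewrite /fflv_key; have := nx a; have := nx b.
  case: (ltnP a m.+1); case: (ltnP b m.+1); case: (ltnP a m); case: (ltnP b m);
  case: (ltnP a k); case: (ltnP b k); lia.
have key_b q : (q <= k)%N -> fflv_key q b = (n.*2 - b)%N.
  by move=> qk; rewrite /fflv_key !ifF //; lia.
have key_lo (x : 'I_n) : (x <= m)%N -> fflv_key p x = x.
  by move=> xm; rewrite /fflv_key ifT //; lia.
have key_hi (x : 'I_n) q : (k <= x)%N -> (q <= k)%N -> fflv_key q x = (n.*2 - x)%N.
  by move=> xk qk; rewrite /fflv_key !ifF //; lia.
have lo_x (x : 'I_n) : ~~ (m < x < k)%N ->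
    either_lt (fflv_key m) (fflv_key m.+1) x a && either_lt (fflv_key m) (fflv_key m.+1) x b ->
    (x <= m)%N \/ (b < x)%N.
  move=> Dx /andP[_]; rewrite /either_lt !key_b //; last by lia.
  have [xm|xm] := leqP x m; first by left.
  rewrite !key_hi; lia.
have hi_z (z : 'I_n) : ~~ (m < z < k)%N ->
    either_lt (fflv_key m) (fflv_key m.+1) a z && either_lt (fflv_key m) (fflv_key m.+1) b z ->
    (k <= z)%N /\ (z < b)%N.
  move=> Dz /andP[]; rewrite /either_lt !key_b //; last by lia.
  have [zk|zk] := leqP k z; first by rewrite !(key_hi z); lia.
  have zm : (z <= m)%N by lia.
  rewrite /fflv_key am !ltnn ltnSn mk; have := nx z; have := nx a; have := nx b.
  by case: (ltnP z m); case: (ltnP z m.+1); case: (ltnP z k); lia.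
split=> [x Dx /(lo_x _ Dx) lx|x z Dx Dz xab /(hi_z _ Dz)[zk zb]].
  right; rewrite key_b; last by lia.
  by have := nx b; case: lx => h; [rewrite key_lo | rewrite key_hi]; lia.
rewrite (key_hi z) //; last by lia.
have := nx x; have := nx z; have := nx b.
case: xab => [->|->|/(lo_x _ Dx)[h|h]];
  [rewrite key_lo | rewrite key_b | rewrite key_lo | rewrite key_hi]; lia.
Qed.

Lemma diagonal_to_fflv : mutation_path R (diagonal_mf k n) (greedy_mf fflv_key).
Proof.
have kn' := ltnW kn.
have -> : diagonal_mf k n = greedy_mf (first_rows k val fflv_key).
  apply: greedy_mf_unique => [i|I].
    by rewrite /first_rows; case: ifP => _; [exact: val_inj | exact: fflv_key_inj].
  apply/greedyP => p q qp; rewrite /first_rows ltn_ord.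
  exact: (greedyP _ _ (diagonal_greedy I)).
have reach m : (m <= k)%N -> mutation_path R
    (greedy_mf (first_rows m (fflv_key m) fflv_key) : matching_field k n) (greedy_mf fflv_key).
  elim: m => [_|m IH mk].
    by rewrite (@eq_greedy_mf k n _ fflv_key) //; exact: mutation_path_refl.
  apply: mutation_path_trans (IH (ltnW mk)).
  have -> : greedy_mf (first_rows m (fflv_key m) fflv_key)
      = greedy_mf (first_rows m.+1 (fflv_key m) fflv_key) :> matching_field k n.
    apply: eq_greedy_mf => p x y _; rewrite /first_rows ltnS.
    by case: (ltngtP p m) => // ->.
  apply: (@sort_path R k n _ _ _ (fun x => ~~ (m < x < k)%N)) => //; try exact: fflv_key_inj.
  - exact: fflv_occurs.
  - exact: fflv_sortable.
apply: mutation_path_trans (reach k (leqnn k)).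
apply: (@sort_path R k n _ _ _ xpredT) => //; try exact: fflv_key_inj.
by move=> a b _ _ p; lia.
Qed.

End FFLVKeys.

(** * Unimodular equivalence and decomposition into indicators *)

Section Unimodular.
Variables (R : realType) (E E' : lmodType R) (f : E -> E') (g : E' -> E).
Hypotheses (fa : affine f) (ga : affine g).

Lemma affine_hull (F F' : lmodType R) (h : F -> F') C (A : set F) x : affine h ->
  hull_with C A x -> hull_with C (h @` A) (h x).
Proof.
move=> ha [m [c [v [Cc Av c1 ->]]]]; exists m, c, (h \o v); split=> // [i|].
  by exists (v i).
exact: ha.
Qed.

Lemma cancel_hull C (A : set E) : (forall x, A x -> g (f x) = x) ->
  forall x, hull_with C A x -> g (f x) = x.
Proof.
move=> gf x [m [c [v [Cc Av c1 ->]]]]; rewrite fa // ga //.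
by apply: eq_bigr => i _; rewrite gf.
Qed.

Lemma hull_bij C (A : set E) : (forall x, A x -> g (f x) = x) ->
  set_bij (hull_with C A) (hull_with C (f @` A)) f.
Proof.
move=> gf; have gfh := cancel_hull gf; split.
- by move=> x /(affine_hull fa).
- move=> x y /set_mem hx /set_mem hy e.
  by rewrite -(gfh C x hx) -(gfh C y hy) e.
- move=> y hy; exists (g y).
    have := affine_hull ga hy.
    suff -> : g @` (f @` A) = A by [].
    apply/seteqP; split=> [_ [_ [x Ax <-] <-]|x Ax]; first by rewrite gf.
    by exists (f x); [exists x | rewrite gf].
  case: hy => m [c [v [Cc Av c1 ->]]]; rewrite ga // fa //.
  by apply: eq_bigr => i _; have [x Ax <-] := Av i; rewrite gf.
Qed.

Lemma vertices_image (P : set E) : (forall x, P x -> g (f x) = x) ->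
  vertices (f @` P) = f @` vertices P.
Proof.
move=> gf; apply/seteqP; split.
  move=> _ [[x Px <-] H]; exists x => //; split=> // y z t Py Pz t01 e.
  rewrite -(gf y) // -(gf z) //; congr g.
  by apply: (H _ _ t) => //; rewrite e affine2.
move=> _ [x [Px H] <-]; split; first by exists x.
move=> _ _ t [y Py <-] [z Pz <-] t01 e; congr f; apply: (H _ _ t) => //.
by rewrite -{1}(gf x) // e affine2 // !gf.
Qed.

(** The affine left inverse extends from [X] to all affine combinations, and affine
bijections carry vertices to vertices; so the two lattices correspond whatever
the vertices are. *)
Lemma unimodular_conv (X : set E) : (forall x, X x -> g (f x) = x) ->
  unimodular_equiv (conv X) (conv (f @` X)).
Proof.
move=> gf; have gfP := cancel_hull gf.
have fP : f @` conv X = conv (f @` X).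
  have [H1 _ H2] := hull_bij [set t | 0 <= t] gf.
  by apply/seteqP; split=> // _ [x Xx <-]; exact: H1.
exists f; split.
- by move=> x y t _ _; exact: affine2.
- by rewrite -fP; apply: hull_bij => x; exact: gfP.
- exact: fP.
- rewrite /dist_lattice -fP vertices_image; last by move=> x; exact: gfP.
  by apply: hull_bij => x [Px _]; exact: gfP Px.
Qed.

End Unimodular.

Section IntervalDecomposition.
Variables (R : realType) (T : finType) (l u : T -> R).
Local Notation V := {ffun T -> R^o}.
Variable Y : set V.
Hypothesis lu : forall p, l p <= u p.
Hypothesis Yt : forall t : R, 0 < t <= 1 -> Y [ffun p => (l p < t <= u p)%R%:R].

(** The sorted list [s] contains all endpoints of the intervals that exceed [b].  For
[t] between two consecutive entries the set of intervals that contain [t] does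
not change; its indicator gets the distance of the two entries as its weight. *)
Lemma wcomb_levels (s : seq R) b : path <=%R b s -> 0 <= b -> all (<= 1) s ->
  (forall p, (l p <= b \/ l p \in s) /\ (u p <= b \/ u p \in s)) ->
  wcomb Y (last b s - b) [ffun p => Num.max (u p) b - Num.max (l p) b].
Proof.
elim: s b => [|b1 s IH] b /=.
  move=> _ _ _ H; rewrite subrr.
  have -> : [ffun p => Num.max (u p) b - Num.max (l p) b] = 0 :> V.
    apply/ffunP => p; rewrite !ffunE; have [[lb|//] [ub|//]] := H p.
    by rewrite !max_r // subrr.
  exact: wcomb0.
move=> /andP[bb1 ps] b0 /andP[b1_1 s1] H.
have sb1 v : v \in s -> b1 <= v.
  move=> vs; have := ps; rewrite path_sortedE; last exact: le_trans.
  by move=> /andP[/allP/(_ _ vs)].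
have step v : v <= b \/ v \in b1 :: s ->
    Num.max v b = Num.max v b1 - (v < b1)%R%:R * (b1 - b).
  rewrite inE; case=> [vb|/orP vb].
    rewrite !max_r // ?(le_trans vb) //.
    have [vb1|] := ltP v b1; first by rewrite mul1r; lra.
    by rewrite mul0r subr0 => ?; lra.
  have b1v : b1 <= v by case: vb => [/eqP -> //|/sb1].
  by rewrite !max_l // ?(le_trans bb1) // ltNge b1v mul0r subr0.
have -> : last b1 s - b = (b1 - b) + (last b1 s - b1) by ring.
have -> : [ffun p => Num.max (u p) b - Num.max (l p) b]
   = (b1 - b) *: [ffun p => (l p < b1 <= u p)%R%:R : R^o]
     + [ffun p => Num.max (u p) b1 - Num.max (l p) b1] :> V.
  apply/ffunP => p; rewrite !ffunE; have [Hl Hu] := H p.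
  rewrite (step _ Hl) (step _ Hu) /GRing.scale /=.
  have [lb1|b1l] := ltP (l p) b1; have [ub1|b1u] := ltP (u p) b1; rewrite /=; try lra.
  by have := lu p; lra.
apply: wcombD.
  have [e|nb] := eqVneq b b1; first by rewrite e subrr scale0r; exact: wcomb0.
  apply: wcomb_scale; first by rewrite subr_ge0.
  by apply: Yt; rewrite b1_1 andbT (le_lt_trans b0) // lt_neqAle nb.
apply: IH => //; first exact: le_trans b0 bb1.
move=> p; have [Hl Hu] := H p.
by split; [move: Hl | move: Hu]; rewrite inE => -[h|/orP[/eqP->|h]];
  [left; exact: le_trans h bb1 | left | right | left; exact: le_trans h bb1 | left | right].
Qed.

(** The length of an interval in [0, 1] is the integral over [t] of its indicator. *)
Lemma conv_levels : (forall p, 0 <= l p) -> (forall p, u p <= 1) ->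
  conv Y [ffun p => u p - l p].
Proof.
move=> l0 u1.
pose s := rcons (sort <=%R (codom l ++ codom u)) 1.
have Hl p : l p \in s by rewrite mem_rcons inE mem_sort mem_cat codom_f orbT.
have Hu p : u p \in s by rewrite mem_rcons inE mem_sort mem_cat codom_f !orbT.
have ss v : v \in codom l ++ codom u -> 0 <= v <= 1.
  rewrite mem_cat => /orP[] /codomP[p ->].
    by rewrite l0 (le_trans (lu p)).
  by rewrite u1 (le_trans _ (lu p)).
have s01 : all (fun v => 0 <= v <= 1) s.
  rewrite all_rcons ler01 lexx /=; apply/allP => v; rewrite mem_sort; exact: ss.
have ps : path <=%R 0 s.
  rewrite path_sortedE; last exact: le_trans.
  rewrite (sub_all _ s01) /=; last by move=> v /andP[].
  rewrite /s; have := sort_le_sorted (codom l ++ codom u).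
  have : all (<= 1) (sort <=%R (codom l ++ codom u)).
    by apply/allP => v; rewrite mem_sort => /ss/andP[].
  case: (sort _ _) => //= x t /andP[x1 t1] pt; rewrite rcons_path pt /=.
  by have /allP := t1; case: t {pt t1} => //= y t H; apply: H; rewrite mem_last.
have := wcomb_levels ps (lexx 0).
rewrite last_rcons subr0.
have -> : [ffun p => u p - l p] = [ffun p => Num.max (u p) 0 - Num.max (l p) 0] :> V.
  by apply/ffunP => p; rewrite !ffunE !max_l // (le_trans (l0 p)).
apply; first by apply: sub_all s01 => v /andP[].
by move=> p; rewrite Hl Hu; split; right.
Qed.

End IntervalDecomposition.

(** * The order polytope *)

Section OrderPolytope.
Variables (R : realType) (k n : nat).
Hypothesis kn : (k < n)%N.
Local Notation grid := (grid_poset k n).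
Local Notation W := {ffun grid -> R^o}.

Lemma gridW (p q : grid) : (p < q)%O -> (p.1 <= q.1)%N && (p.2 <= q.2)%N.
Proof. by move=> /ltW; rewrite leEprod !leEord. Qed.

Lemma grid_lt (p q : grid) : p != q -> (p.1 <= q.1)%N -> (p.2 <= q.2)%N -> (p < q)%O.
Proof. by move=> pq h1 h2; rewrite lt_def eq_sym pq leEprod !leEord h1. Qed.

Lemma increasing_gap (j : 'I_k -> 'I_n) : greedy (fun _ => val) j ->
  forall i i' : 'I_k, (i <= i')%N -> (j i + (i' - i) <= j i')%N.
Proof.
move=> /greedyP vj i; suff H d (i' : 'I_k) : (i' = i + d :> nat)%N -> (j i + d <= j i')%N.
  by move=> i' ii'; apply: H; lia.
elim: d i' => [|d IH] i' e.
  by have -> : i' = i; [apply: val_inj; rewrite /= e addn0 | rewrite addn0].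
have dk : (i + d < k)%N by have := ltn_ord i'; lia.
have := IH (Ordinal dk) erefl; have /= := vj i' (Ordinal dk); rewrite e; lia.
Qed.

Lemma increasing_range (j : 'I_k -> 'I_n) : greedy (fun _ => val) j ->
  forall i : 'I_k, (i <= j i <= i + (n - k))%N.
Proof.
move=> vj i; have k0 : (0 < k)%N by have := ltn_ord i; lia.
have k1 : (k.-1 < k)%N by lia.
have := increasing_gap vj (i := Ordinal k0) (i' := i).
have := increasing_gap vj (i := i) (i' := Ordinal k1).
have := ltn_ord i; have := ltn_ord (j (Ordinal k1)); rewrite /=; lia.
Qed.

(** The partial row sums: for the point of an increasing tuple [j], the coordinate at
[(i, m)] tells whether [j i - i >= n - k - m]. *)
Definition gt_map (x : 'M[R]_(k, n)) : W :=
  [ffun p : grid => \sum_(c < n | (p.1 + (n - k) - p.2 <= c)%N) x p.1 c].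

(** The partial sum of row [i] over the columns from [i + t], recovered from the image;
it is 1 for [t = 0] and 0 for [t > n - k] since [i <= j i <= i + (n - k)]. *)
Definition gt_coord (y : W) (i : 'I_k) (t : nat) : R :=
  if t == 0%N then 1 else if (t <= n - k)%N then
    oapp (fun m : 'I_(n - k) => y (i, m)) 0 (insub (n - k - t)%N) else 0.

Definition gt_inv (y : W) : 'M[R]_(k, n) := \matrix_(i, c)
  (if (i <= c)%N then gt_coord y i (c - i) - gt_coord y i (c - i).+1 else 0).

Lemma gt_map_affine : affine gt_map.
Proof.
apply: affine_ffun => p m c v c1; rewrite !ffunE.
under eq_bigr do rewrite summxE.
rewrite exchange_big; apply: eq_bigr => i _; rewrite ffunE scaler_sumr.
by apply: eq_bigr => l _; rewrite mxE.
Qed.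

Lemma gt_coord_affine i t : affine (fun y => gt_coord y i t : R^o).
Proof.
rewrite /gt_coord; case: eqP => _; first exact: affine_cst.
case: leqP => _; last exact: affine_cst.
case: insub => [m|] /=; [exact: affine_eval | exact: affine_cst].
Qed.

Lemma gt_inv_affine : affine gt_inv.
Proof.
apply: affine_mx => i c m d v d1; rewrite !mxE.
case: leqP => ic; last first.
  by rewrite big1 // => l _; rewrite mxE leqNgt ic /= scaler0.
have := @affineB R _ _ _ _ (gt_coord_affine i (c - i)) (gt_coord_affine i (c - i).+1).
by move=> /(_ m d v d1) /= ->; apply: eq_bigr => l _; rewrite mxE ic.
Qed.

Lemma gt_map_point (j : 'I_k -> 'I_n) (p : grid) :
  gt_map (tuple_point R j) p = (p.1 + (n - k) - p.2 <= j p.1)%N%:R.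
Proof.
rewrite ffunE; under eq_bigr do rewrite tuple_pointE.
case: leqP => h.
  rewrite (bigD1 (j p.1)) //= eqxx big1 ?addr0 // => c /andP[_ cj].
  by rewrite eq_sym (negbTE cj).
apply: big1 => c hc; case: eqP => // e; move: hc; rewrite -e; lia.
Qed.

Lemma gt_coord_point (j : 'I_k -> 'I_n) i t : greedy (fun _ => val) j ->
  gt_coord (gt_map (tuple_point R j)) i t = (i + t <= j i)%N%:R.
Proof.
move=> vj; have /andP[j1 j2] := increasing_range vj i.
rewrite /gt_coord; case: eqP => [->|/eqP t0]; first by rewrite addn0 j1.
case: leqP => tn; last by have -> : (i + t <= j i)%N = false by lia.
case: insubP => [m mlt em|]; last by rewrite -leqNgt; have := ltn_ord i; lia.
rewrite /= gt_map_point /= em; congr (nat_of_bool (_ <= _)%N)%:R.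
by lia.
Qed.

Lemma gt_invK (j : 'I_k -> 'I_n) : greedy (fun _ => val) j ->
  gt_inv (gt_map (tuple_point R j)) = tuple_point R j.
Proof.
move=> vj; apply/matrixP => i c; rewrite tuple_pointE mxE.
have /andP[j1 j2] := increasing_range vj i.
case: leqP => ic; last first.
  by case: eqP => // e; move: ic; rewrite -e; lia.
rewrite !gt_coord_point // addnS subnKC //.
case: eqP => [e|/eqP e]; first by rewrite e leqnn ltnn subr0.
have /negbTE e' : c != j i :> nat by rewrite eq_sym.
by rewrite leq_eqVlt e' subrr.
Qed.

Lemma order_polytope_affine m (c : 'I_m -> R) (v : 'I_m -> W) :
  (forall i, 0 <= c i) -> (forall i, order_polytope R grid (v i)) -> \sum_i c i = 1 ->
  order_polytope R grid (\sum_i c i *: v i).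
Proof.
move=> c0 Qv c1; split=> [p q pq|p]; rewrite !sum_ffunE.
  apply: ler_sum => i _; rewrite !ffunE; apply: ler_wpM2l => //.
  by case: (Qv i) => H _; exact: H.
apply/andP; split.
  apply: sumr_ge0 => i _; rewrite ffunE; apply: mulr_ge0 => //.
  by case: (Qv i) => _ /(_ p)/andP[].
rewrite -c1; apply: ler_sum => i _; rewrite ffunE -[leRHS]mulr1.
by apply: ler_wpM2l => //; case: (Qv i) => _ /(_ p)/andP[].
Qed.

(** A point [x] is made of the intervals from [1 - x p] to 1, and the intervals that
contain a given level form a filter.  A filter is determined by the numbers
[cnt i] of its elements in the rows, which increase weakly with [i]; it is the
image of the increasing tuple [j i = i + cnt i]. *)
Lemma order_polytope_hull :
  order_polytope R grid = conv (gt_map @` (greedy_points R (fun _ => val) : set 'M[R]_(k, n))).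
Proof.
apply/seteqP; split=> [x [xm x01]|_ [m [c [v [c0 Xv c1 ->]]]]]; last first.
  apply: order_polytope_affine => // i; have [_ [j vj ->] <-] := Xv i.
  split=> [[p1 p2] [q1 q2] /gridW /= /andP[h1 h2]|p]; rewrite !gt_map_point /=; last first.
    by rewrite ler0n lern1 leq_b1.
  rewrite ler_nat; have gap := increasing_gap vj h1.
  case: (leqP (p1 + _ - _)%N) => // h3.
  suff -> : (q1 + (n - k) - q2 <= j q1)%N by [].
  by have := ltn_ord p2; lia.
have -> : x = [ffun p => 1 - (1 - x p)].
  by apply/ffunP => p; rewrite ffunE opprB addrC subrK.
apply: (@conv_levels R grid (fun p => 1 - x p) (fun=> 1)) => [p|t /andP[t0 t1]|p|//].
- by have /andP[] := x01 p; lra.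
- pose A (i : 'I_k) : pred 'I_(n - k) := fun m => (1 - x (i, m) < t)%R.
  pose cnt i := (\max_(m | A i m) (n - k - m))%N.
  have cnt_le i : (cnt i <= n - k)%N by apply/bigmax_leqP => m _; exact: leq_subr.
  have A_up (i i' : 'I_k) (m m' : 'I_(n - k)) : (i <= i')%N -> (m <= m')%N -> A i m -> A i' m'.
    move=> ii' mm'; rewrite /A; apply: le_lt_trans; rewrite lerD2l lerN2.
    have [[-> ->] //|ne] := eqVneq (i, m) (i', m').
    exact/xm/grid_lt.
  have cntE i (m : 'I_(n - k)) : (n - k - m <= cnt i)%N = A i m.
    apply/idP/idP => [h|Am]; last exact: leq_bigmax_cond.
    have [m' Am' e] : {m' | A i m' & cnt i = (n - k - m')%N}.
      have [m0 Am0|A0] := pickP (A i).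
        by apply: eq_bigmax_cond; apply/card_gt0P; exists m0.
      by move: h; rewrite /cnt big_pred0 //; have := ltn_ord m; lia.
    by apply: A_up Am' => //; move: h; rewrite e; have := ltn_ord m; have := ltn_ord m'; lia.
  have cnt_mono (i i' : 'I_k) : (i <= i')%N -> (cnt i <= cnt i')%N.
    move=> ii'; apply/bigmax_leqP => m Am; rewrite cntE.
    exact: A_up Am.
  have jn (i : 'I_k) : (i + cnt i < n)%N by have := cnt_le i; have := ltn_ord i; lia.
  pose j i := Ordinal (jn i).
  have vj : greedy (fun _ => val) j.
    by apply/greedyP => p q qp /=; have := cnt_mono q p (ltnW qp); lia.
  exists (tuple_point R j); first by exists j.
  apply/ffunP => -[i m]; rewrite gt_map_point ffunE t1 andbT /=; congr (nat_of_bool _)%:R.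
  rewrite -/(A i m) -cntE; have := ltn_ord m; have := ltn_ord i; lia.
- by have /andP[] := x01 p; lra.
Qed.

Lemma order_polytope_unimodular (L : matching_field k n) :
  (forall I, greedy (fun _ => val) (mf_tuple L I)) ->
  unimodular_equiv (mf_polytope R L) (order_polytope R grid).
Proof.
move=> vL; rewrite (mf_polytopeE R vL) order_polytope_hull.
apply: (unimodular_conv gt_map_affine gt_inv_affine) => _ [j vj ->].
exact: gt_invK.
Qed.

End OrderPolytope.

(** * The chain polytope *)

Section ChainPolytope.
Variables (R : realType) (k n : nat).
Hypothesis kn : (k < n)%N.
Local Notation grid := (grid_poset k n).
Local Notation W := {ffun grid -> R^o}.
Local Notation key := (@fflv_key k n).

(** The entry of row [i] cannot be between [i] and [k] by [fflv_occurs].  If it were a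
column [c < i], the key of row [i] would force the entries of all earlier rows
below [c]; then row [c] would contain a column before [c], and so on downwards. *)
Lemma fflv_low (j : 'I_k -> 'I_n) (i : 'I_k) : greedy key j -> (j i < k)%N -> j i = i :> nat.
Proof.
move=> vj jk; have vP := greedyP _ _ vj.
have := fflv_occurs kn (ltn_ord i) (kap := key) (fun _ _ => erefl) vj (ltnSn i).
rewrite jk andbT -leqNgt leq_eqVlt => /orP[/eqP //|].
have [d] := ubnP (i : nat); elim: d i jk => // d IH i jk id_ ji.
pose c := Ordinal jk.
have := vP i c ji; rewrite /fflv_key ji /= => H.
have [c1 c2] : (j c < k)%N /\ (j c < j i)%N.
  by move: H; have := ltn_ord (j c); case: (ltnP (j c) i); case: (ltnP (j c) k); lia.
by have := IH c c1; rewrite /=; lia.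
Qed.

Lemma fflv_high (j : 'I_k -> 'I_n) (q p : 'I_k) : greedy key j -> (q < p)%N ->
  (k <= j q)%N -> (k <= j p)%N -> (j p < j q)%N.
Proof.
move=> /greedyP vj qp kq kp; have := vj _ _ qp.
rewrite /fflv_key !ifF; have := ltn_ord (j q); have := ltn_ord (j p); have := ltn_ord p; lia.
Qed.

Lemma big_column_subproof (m : 'I_(n - k)) : (k + m < n)%N.
Proof. by have := ltn_ord m; lia. Qed.

Definition big_column (m : 'I_(n - k)) : 'I_n := Ordinal (big_column_subproof m).

Definition fflv_map (x : 'M[R]_(k, n)) : W := [ffun p : grid => x p.1 (big_column p.2)].

(** In row [i] the entry in column [i] is what is missing to a row sum of 1. *)
Definition fflv_inv (y : W) : 'M[R]_(k, n) := \matrix_(i, c)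
  (if (k <= c)%N then oapp (fun m : 'I_(n - k) => y (i, m)) 0 (insub (c - k)%N)
   else if c == i :> nat then 1 - \sum_(m < n - k) y (i, m) else 0).

Lemma fflv_map_affine : affine fflv_map.
Proof.
apply: affine_ffun => p m c v c1; rewrite !ffunE summxE.
by apply: eq_bigr => l _; rewrite ffunE mxE.
Qed.

Lemma fflv_inv_affine : affine fflv_inv.
Proof.
apply: affine_mx => i c.
suff : affine (fun y : W => (if (k <= c)%N then
     oapp (fun m : 'I_(n - k) => y (i, m)) 0 (insub (c - k)%N)
   else if c == i :> nat then 1 - \sum_(m < n - k) y (i, m) else 0) : R^o).
  move=> H m d v d1; rewrite mxE; have /= -> := H m d v d1.
  by apply: eq_bigr => l _; rewrite mxE.
case: leqP => _.
  by case: insub => [m|] /=; [exact: affine_eval | exact: affine_cst].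
case: eqP => _; last exact: affine_cst.
apply: (@affineB R W R^o (fun=> 1) (fun y => \sum_(m < n - k) y (i, m))).
  exact: affine_cst.
by apply: (@affine_sum R W R^o) => m; exact: affine_eval.
Qed.

Lemma fflv_map_point (j : 'I_k -> 'I_n) (p : grid) :
  fflv_map (tuple_point R j) p = (j p.1 == big_column p.2)%:R.
Proof. by rewrite ffunE tuple_pointE. Qed.

Lemma fflv_invK (j : 'I_k -> 'I_n) : greedy key j ->
  fflv_inv (fflv_map (tuple_point R j)) = tuple_point R j.
Proof.
move=> vj; apply/matrixP => i c; rewrite tuple_pointE mxE.
case: leqP => kc.
  case: insubP => [m _ em|]; last by have := ltn_ord c; lia.
  rewrite /= fflv_map_point /=; congr (nat_of_bool (_ == _))%:R.
  by apply: val_inj; rewrite /= em; lia.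
have sum_big : \sum_(m < n - k) fflv_map (tuple_point R j) (i, m) = (k <= j i)%N%:R.
  under eq_bigr do rewrite fflv_map_point /=.
  case: leqP => h.
    have jm : (j i - k < n - k)%N by have := ltn_ord (j i); lia.
    rewrite (bigD1 (Ordinal jm)) //= big1 => [|m mj].
      rewrite addr0; have -> : big_column (Ordinal jm) = j i; last by rewrite eqxx.
      by apply: val_inj; rewrite /=; lia.
    case: eqP => // e; case/eqP: mj; apply: val_inj; rewrite /= e /=; lia.
  by apply: big1 => m _; case: eqP => // e; move: h; rewrite e /=; lia.
case: eqP => [ci|/eqP ci].
  rewrite sum_big; case: (leqP k (j i)) => h.
    by rewrite subrr; case: eqP => // e; move: kc; rewrite -e; lia.
  rewrite subr0; suff -> : j i = c by rewrite eqxx.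
  by apply: val_inj; rewrite /= ci; exact: fflv_low.
case: eqP => // e; case/eqP: ci; rewrite -e; apply: fflv_low => //.
by rewrite e.
Qed.

Lemma chain_polytope_affine m (c : 'I_m -> R) (v : 'I_m -> W) :
  (forall i, 0 <= c i) -> (forall i, chain_polytope R grid (v i)) -> \sum_i c i = 1 ->
  chain_polytope R grid (\sum_i c i *: v i).
Proof.
move=> c0 Qv c1; split=> [s ss|p].
  under eq_bigr do rewrite sum_ffunE.
  rewrite exchange_big -c1; apply: ler_sum => i _.
  under eq_bigr do rewrite ffunE.
  rewrite -mulr_sumr -[leRHS]mulr1; apply: ler_wpM2l => //.
  by case: (Qv i) => /(_ s ss).
rewrite sum_ffunE; apply: sumr_ge0 => i _; rewrite ffunE; apply: mulr_ge0 => //.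
by case: (Qv i).
Qed.

(** The entries that are at least [k] decrease with the row, so the corresponding
elements of the grid are pairwise incomparable. *)
Lemma fflv_antichain (j : 'I_k -> 'I_n) (p q : grid) : greedy key j -> (p < q)%O ->
  j p.1 = big_column p.2 -> j q.1 = big_column q.2 -> False.
Proof.
move: p q => [p1 p2] [q1 q2] vj pq /= ep eq_.
have /andP[/= h1 h2] := gridW pq.
move: h1; rewrite leq_eqVlt => /orP[/eqP/val_inj e1|h1].
  have e2 : p2 = q2.
    by move: eq_; rewrite -e1 ep => /(congr1 val) /= /addnI/val_inj.
  by move: pq; rewrite e1 e2 ltxx.
by have := fflv_high vj h1; rewrite ep eq_ /=; lia.
Qed.

Lemma fflv_map_chain (j : 'I_k -> 'I_n) : greedy key j ->
  chain_polytope R grid (fflv_map (tuple_point R j)).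
Proof.
move=> vj; split=> [s ss|p]; last by rewrite fflv_map_point ler0n.
under eq_bigr do rewrite fflv_map_point.
move: ss; rewrite lt_sorted_pairwise; elim: s => [|p s IH] /=; first by rewrite big_nil ler01.
move=> /andP[ps ss]; rewrite big_cons; case: eqP => [e|_]; last by rewrite add0r IH.
rewrite big_seq big1 ?addr0 // => q qs; case: eqP => // eq_.
by case: (fflv_antichain vj (allP ps q qs) e eq_).
Qed.

(** Take for [u p] the supremum of the sums of [x] over the chains that end at [p]. *)
Lemma chain_heights (x : W) : chain_polytope R grid x ->
  exists u : grid -> R, [/\ forall p, x p <= u p, forall p, u p <= 1
    & forall p q, (p < q)%O -> u p + x q <= u q].
Proof.
move=> [xs x0].
pose S p := [set z : R | exists2 s : seq grid, sorted <%O (rcons s p) &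
  z = \sum_(r <- rcons s p) x r].
have S1 p : ubound (S p) 1 by move=> _ [s ss ->]; exact: xs.
have Sx p : S p (x p) by exists [::] => //=; rewrite big_seq1.
have ubS p : has_ubound (S p) by exists 1.
exists (fun p => sup (S p)); split=> [p|p|p q pq].
- exact: ub_le_sup.
- by apply: ge_sup => //; exists (x p).
- rewrite -lerBrDr; apply: ge_sup; first by exists (x p).
  move=> _ [s ss ->]; rewrite lerBrDr; apply: ub_le_sup => //.
  exists (rcons s p); last by rewrite [RHS]big_rcons /= addrC.
  by case: s ss => [|r s] /=; rewrite ?pq // => ss; rewrite rcons_path ss last_rcons.
Qed.

(** With the heights [u] of [chain_heights], the intervals from [u p - x p] to [u p] of
two comparable elements are disjoint, so the intervals that contain a given level
form an antichain.  Its elements are in different rows, and their columns decrease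
with the row; putting them in their rows and [i] in each other row [i] gives a
greedy tuple. *)
Lemma chain_polytope_hull :
  chain_polytope R grid = conv (fflv_map @` (greedy_points R key : set 'M[R]_(k, n))).
Proof.
apply/seteqP; split=> [x xQ|_ [m [c [v [c0 Xv c1 ->]]]]]; last first.
  apply: chain_polytope_affine => // i; have [_ [j vj ->] <-] := Xv i.
  exact: fflv_map_chain.
have [xs x0] := xQ; have [u [xu u1 uD]] := chain_heights xQ.
have -> : x = [ffun p => u p - (u p - x p)].
  by apply/ffunP => p; rewrite ffunE opprB addrC subrK.
apply: (@conv_levels R grid (fun p => u p - x p) u) => [p|t /andP[t0 t1]|p|//].
- by rewrite lerBlDr lerDl.
- pose A (p : grid) := (u p - x p < t <= u p)%R.
  have anti p q : A p -> A q -> ~~ (p < q)%O.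
    move=> /andP[_ h1] /andP[h2 _]; apply/negP => /uD; lra.
  pose j (i : 'I_k) : 'I_n := if [pick m | A (i, m)] is Some m then big_column m
    else widen_ord (ltnW kn) i.
  have jP i : (exists2 m, A (i, m) & j i = big_column m) \/ (j i = i :> nat).
    by rewrite /j; case: pickP => [m Am|_]; [left; exists m | right].
  have vj : greedy key j.
    apply/greedyP => p q qp; have pk := ltn_ord p; have jn := ltn_ord (j q).
    have [[m Am jm]|jp] := jP p; have [[m' Am' jm']|jq] := jP q.
    + have mm' : (m < m')%N.
        rewrite ltnNge; apply/negP => m'm; have := anti _ _ Am' Am.
        rewrite grid_lt //; last exact: ltnW.
        by apply/eqP => -[e _]; move: qp; rewrite e ltnn.
      rewrite jm jm' /fflv_key /=; have := ltn_ord m; have := ltn_ord m'.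
      by rewrite !ifF; lia.
    + rewrite jm /fflv_key jq qp /=; have := ltn_ord m; rewrite !ifF; lia.
    + by rewrite jm' /fflv_key jp ltnn ltn_ord /= !ifF; lia.
    + by rewrite /fflv_key jq jp qp ltnn ltn_ord; lia.
  exists (tuple_point R j); first by exists j.
  apply/ffunP => -[i m]; rewrite fflv_map_point ffunE /= -/(A (i, m)).
  congr (nat_of_bool _)%:R; rewrite /j; case: pickP => [m' Am'|nA]; last first.
    rewrite nA; apply/eqP => /(congr1 val) /=; have := ltn_ord i; lia.
  apply/eqP/idP => [/(congr1 val) /= /addnI/val_inj <- //|Am].
  congr big_column; apply: val_inj; have [h|h|//] := ltngtP m' m.
    have := anti _ _ Am' Am; rewrite grid_lt //=; last exact: ltnW.
    by apply/eqP => -[e]; move: h; rewrite e ltnn.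
  have := anti _ _ Am Am'; rewrite grid_lt //=; last exact: ltnW.
  by apply/eqP => -[e]; move: h; rewrite e ltnn.
- by rewrite subr_ge0.
Qed.

Lemma chain_polytope_unimodular (L : matching_field k n) :
  (forall I, greedy key (mf_tuple L I)) ->
  unimodular_equiv (mf_polytope R L) (chain_polytope R grid).
Proof.
move=> vL; rewrite (mf_polytopeE R vL) chain_polytope_hull.
apply: (unimodular_conv fflv_map_affine fflv_inv_affine) => _ [j vj ->].
exact: fflv_invK.
Qed.

End ChainPolytope.

Theorem theorem3p11 (R : realType) (k n : nat) (hk : (1 <= k)%N)
    (hkn : (k < n)%N) :
  exists (s : nat) (L : nat -> matching_field k n),
    [/\ L 0%N = diagonal_mf k n,
        unimodular_equiv (mf_polytope R (L 0%N))
          (order_polytope R (grid_poset k n)),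
        unimodular_equiv (mf_polytope R (L s))
          (chain_polytope R (grid_poset k n))
      & forall i : nat, (1 <= i <= s)%N ->
          combinatorial_mutation (mf_polytope R (L i.-1))
                                 (mf_polytope R (L i))].
Proof.
have [s [L [L0 Ls steps]]] := diagonal_to_fflv R hkn.
exists s, L; split=> //.
- rewrite L0; apply: order_polytope_unimodular => // I; exact: diagonal_greedy.
- rewrite Ls; apply: chain_polytope_unimodular => //.
  by apply: greedy_mf_tuples => i; exact: fflv_key_inj.
Qed.
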